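(* Let $k\ge 3$ and $G=\mathbb{Z}/2\mathbb{Z}\star\mathbb{Z}/k\mathbb{Z}$, with $a$ and $b$ generators of $\mathbb{Z}/2\mathbb{Z}$ and $\mathbb{Z}/k\mathbb{Z}$ respectively, and let $\Sigma=\{a,b,b^2,\dots,b^{k-1}\}$. Let $\mu$ be the probability measure with $\mu(a)=\mu(b)=\mu(b^{-1})=1/3$. Define $G_n:[0,1]\to\mathbb{R}$, $n\in\mathbb{N}$, by $$G_0(x)=\frac14+\frac x2,\qquad G_1(x)=x,\qquad G_n(x)=\frac{8(1-x)}{3-2x}\,G_{n-1}(x)-G_{n-2}(x)\quad(n\ge 2),$$ and let $y_k$ be the unique solution in $(0,1/2)$ of $G_{k-1}(y_k)=y_k$ (that such a unique solution exists is part of the statement). Then the harmonic measure of the random walk $(G,\mu)$ is the Markovian multiplicative measure associated with the vector $r$ given by $$r(a)=G_0(y_k),\qquad r(b^i)=G_i(y_k),\quad i\in\{1,\dots,k-1\}.$$ The drift of the walk (with respect to $\Sigma$) is $\gamma_k=(1-2y_k)/3$. Moreover $\gamma_k$ is a strictly increasing function of $k$ and $\lim_{k\to\infty}\gamma_k=2/9$.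
   Context: For a free product $G=G_1\star G_2$ of two nontrivial finite groups, put $\Sigma_i=G_i\setminus\{1\}$ and $\Sigma=\Sigma_1\sqcup\Sigma_2$; for $u\in\Sigma$, $\Sigma_u$ denotes the $\Sigma_i$ containing $u$. Every $g\in G$ has a unique normal form $g=u_1\cdots u_n$ with $u_j\in\Sigma$ and $u_{j+1}\notin\Sigma_{u_j}$; its length with respect to $\Sigma$ is $|g|=n$. Random walk $(G,\mu)$: $X_0=1$, $X_{n+1}=X_nx_n$ with $(x_n)$ i.i.d. of law $\mu$. The drift is $\gamma=\lim_n |X_n|/n$ (a.s.). When the walk is transient, the normal form of $X_n$ converges a.s., letter by letter, to an infinite normal form word $X_\infty\in\Sigma^{\mathbb{N}}$ (an infinite word with $u_{j+1}\notin\Sigma_{u_j}$ for all $j$); the harmonic measure $\mu^\infty$ is the law of $X_\infty$. For a vector $r\in(0,1)^\Sigma$ with $\sum_{u\in\Sigma}r(u)=1$, write $r(E)=\sum_{u\in E}r(u)$ for $E\subset\Sigma$ and $q(u)=r(u)/r(\Sigma\setminus\Sigma_u)$. The Markovian multiplicative measure associated with $r$ is the probability measure $\nu$ on infinite normal form words such that $\nu(u_1\cdots u_n\Sigma^{\mathbb{N}})=q(u_1)\cdots q(u_{n-1})\,r(u_n)$ for every finite normal form word $u_1\cdots u_n$, where $u_1\cdots u_n\Sigma^{\mathbb{N}}$ is the set of infinite words with prefix $u_1\cdots u_n$. *)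

(* Defs.v *)
From HB Require Import structures.
From mathcomp Require Import all_boot all_order all_algebra all_fingroup.
From mathcomp Require Import all_solvable.
From mathcomp Require Import all_classical all_reals all_analysis.

Set Implicit Arguments.
Unset Strict Implicit.
Unset Printing Implicit Defensive.

Import Order.TTheory GRing.Theory Num.Theory.
Import numFieldNormedType.Exports.

Local Open Scope classical_set_scope.
Local Open Scope ring_scope.

HB.mixin Record isNontrivialGroup G of FinGroup G := {
  ntg_subproof : exists x : G, x != 1%g
}.

#[short(type="ntFinGroupType")]
HB.structure Definition NontrivialFinGroup := {G of isNontrivialGroup G & FinGroup G}.

Lemma ordinal_nontrivial n : exists x : 'I_n.+2, x != 1%g.
Proof. by exists ord_max. Qed.

HB.instance Definition _ n :=
  isNontrivialGroup.Build 'I_n.+2 (ordinal_nontrivial n).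

Section FreeProduct.
Variables G1 G2 : ntFinGroupType.

Definition letter : finType := ({x : G1 | x != 1%g} + {x : G2 | x != 1%g})%type.

Definition same_factor (u v : letter) : bool :=
  match u, v with inl _, inl _ | inr _, inr _ => true | _, _ => false end.

Definition normal (w : seq letter) : bool :=
  sorted (fun u v => ~~ same_factor u v) w.

Arguments normal : simpl never.

(* The free product of G1 and G2: a group element is identified with its normal
   form, and words are multiplied by concatenation followed by reduction. *)
Record freeprod := FreeProd { nform : seq letter; nformP : normal nform }.

HB.instance Definition _ := [isSub for nform].
HB.instance Definition _ := [Choice of freeprod by <:].

(* The normal form of the product of two letters. *)
Definition letter_mul (u v : letter) : seq letter :=
  match u, v with
  | inl x, inl y => seq_of_opt (omap inl (insub (val x * val y)%g))
  | inr x, inr y => seq_of_opt (omap inr (insub (val x * val y)%g))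
  | _, _ => [:: u; v]
  end.

Lemma letter_inv_subproof (G : finGroupType) (x : {x : G | x != 1%g}) :
  (val x)^-1%g != 1%g.
Proof. by rewrite invg_eq1 (valP x). Qed.

Definition letter_inv (u : letter) : letter :=
  match u with
  | inl x => inl (Sub (val x)^-1%g (letter_inv_subproof x))
  | inr x => inr (Sub (val x)^-1%g (letter_inv_subproof x))
  end.

Definition letter_act (u : letter) (w : seq letter) : seq letter :=
  if w is v :: w' then letter_mul u v ++ w' else [:: u].

Definition word_mul (w z : seq letter) : seq letter := foldr letter_act z w.

Definition word_inv (w : seq letter) : seq letter := rev (map letter_inv w).

Lemma same_factor_sym u v : same_factor u v = same_factor v u.
Proof. by case: u; case: v. Qed.

Lemma same_factor_trans u v w :
  same_factor u v -> same_factor u w = same_factor v w.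
Proof. by case: u; case: v; case: w. Qed.

Lemma letter_mul_diff u v : ~~ same_factor u v -> letter_mul u v = [:: u; v].
Proof. by case: u v => [x|x] [y|y]. Qed.

Lemma letter_mul_same u v : same_factor u v ->
  letter_mul u v = [::] \/
  exists2 t, letter_mul u v = [:: t] & same_factor v t.
Proof.
case: u v => [x|x] [y|y] //= _; case: insubP => [z _ _|_] /=; [right|left|right|left] => //.
  by exists (inl z).
by exists (inr z).
Qed.

Lemma normal_cons u w :
  normal (u :: w) = (if w is v :: _ then ~~ same_factor u v else true) && normal w.
Proof. by case: w. Qed.

Lemma normal_behead u w : normal (u :: w) -> normal w.
Proof. by rewrite normal_cons => /andP[]. Qed.

Lemma normal_act u w : normal w -> normal (letter_act u w).
Proof.
case: w => [//|v w] nvw; rewrite /letter_act.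
have [suv|nuv] := boolP (same_factor u v); last first.
  by rewrite letter_mul_diff //= normal_cons nuv.
have [->|[t -> svt]] := letter_mul_same suv; first exact: normal_behead nvw.
move: nvw; rewrite /= !normal_cons => /andP[+ ->].
by case: w => // s w; rewrite (same_factor_trans _ svt) andbT.
Qed.

Lemma normal_mul w z : normal z -> normal (word_mul w z).
Proof. by move=> nz; elim: w => //= u w; exact: normal_act. Qed.

Lemma letter_actA u v w : normal w -> same_factor u v ->
  letter_act u (letter_act v w) =
  (if letter_mul u v is t :: _ then letter_act t w else w).
Proof.
case: w => [|t w].
  by move=> _ suv /=; have [->|[t -> _]] := letter_mul_same suv.
have [svt|nvt] := boolP (same_factor v t) => nw suv; last first.
  rewrite /= (letter_mul_diff nvt) /=.
  have [->//|[s E svs]] := letter_mul_same suv.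
  by rewrite E /= letter_mul_diff // -(same_factor_trans t svs).
have next (s : letter) : same_factor s t -> letter_act s w = s :: w.
  move=> sst; case: w nw => // r w /= /andP[ntr _].
  by rewrite letter_mul_diff // (same_factor_trans _ sst).
have sut : same_factor u t by rewrite (same_factor_trans _ suv).
move: (next u sut) {nw}; case: u v t suv svt sut next => [x|x] [y|y] [t|t] //= _ _ _ next E.
all: have [yt _ ytE|/negbNE/eqP yt1] := insubP _ (val y * val t)%g;
     have [xy _ xyE|/negbNE/eqP xy1] := insubP _ (val x * val y)%g;
     rewrite /= ?ytE ?xyE ?mulgA ?xy1 ?mul1g ?valK -?mulgA ?yt1 ?mulg1 ?valK //.
all: have /val_inj -> // : val t = val x;
     by transitivity (val x * (val y * val t))%g;
       [rewrite mulgA xy1 mul1g | rewrite yt1 mulg1].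
Qed.

Lemma word_mul_act u w z : normal w -> normal z ->
  word_mul (letter_act u w) z = letter_act u (word_mul w z).
Proof.
case: w => // v w nw nz.
have [suv|nuv] := boolP (same_factor u v); last first.
  by rewrite /letter_act letter_mul_diff.
rewrite [in RHS]/word_mul /= -/(word_mul w z) letter_actA ?normal_mul//.
by have [->|[t -> _]] := letter_mul_same suv.
Qed.

Lemma word_mulA v w z : normal w -> normal z ->
  word_mul v (word_mul w z) = word_mul (word_mul v w) z.
Proof. by move=> nw nz; elim: v => //= u v ->; rewrite word_mul_act ?normal_mul. Qed.

Lemma word_mulw1 w : normal w -> word_mul w [::] = w.
Proof.
elim: w => // u w IH nw.
rewrite /word_mul /= -/(word_mul w [::]) IH; last exact: normal_behead nw.
by case: w nw {IH} => //= v w /andP[nuv _]; rewrite letter_mul_diff.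
Qed.

Lemma same_factor_inv u v :
  same_factor (letter_inv u) (letter_inv v) = same_factor u v.
Proof. by case: u; case: v. Qed.

Lemma normal_inv w : normal w -> normal (word_inv w).
Proof.
rewrite /normal /word_inv rev_sorted sorted_map.
case: w => //= u w; apply: sub_path => x y.
by rewrite /= same_factor_inv same_factor_sym.
Qed.

Lemma letter_invK : involutive letter_inv.
Proof. by case=> x /=; congr (_ _); apply: val_inj; rewrite /= invgK. Qed.

Lemma letter_mulV u : letter_mul (letter_inv u) u = [::].
Proof. by case: u => x /=; rewrite mulVg insubN ?eqxx. Qed.

Lemma word_mulV w : normal w -> word_mul (word_inv w) w = [::].
Proof.
elim: w => // u w IH nw.
rewrite /word_inv /= rev_cons /word_mul foldr_rcons /= letter_mulV /=.
exact/IH/normal_behead/nw.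
Qed.

Lemma word_invK : involutive word_inv.
Proof.
move=> w; rewrite /word_inv map_rev revK -map_comp.
by rewrite (eq_map letter_invK) map_id.
Qed.

Definition fp_one : freeprod := @FreeProd [::] isT.
Definition fp_mul (g h : freeprod) : freeprod :=
  FreeProd (normal_mul (nform g) (nformP h)).
Definition fp_inv (g : freeprod) : freeprod := FreeProd (normal_inv (nformP g)).

Lemma fp_mulA : associative fp_mul.
Proof. by move=> x y z; apply: val_inj; rewrite /= word_mulA ?nformP. Qed.
Lemma fp_mul1g : left_id fp_one fp_mul.
Proof. by move=> x; apply: val_inj. Qed.
Lemma fp_mulg1 : right_id fp_one fp_mul.
Proof. by move=> x; apply: val_inj; rewrite /= word_mulw1 ?nformP. Qed.
Lemma fp_mulVg : left_inverse fp_one fp_inv fp_mul.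
Proof. by move=> x; apply: val_inj; rewrite /= word_mulV ?nformP. Qed.
Lemma fp_mulgV : right_inverse fp_one fp_inv fp_mul.
Proof.
move=> x; apply: val_inj; rewrite /= -{1}[nform x]word_invK word_mulV //.
exact/normal_inv/nformP.
Qed.

HB.instance Definition _ :=
  isGroup.Build freeprod fp_mulA fp_mul1g fp_mulg1 fp_mulVg fp_mulgV.

(* The free product is countable and carries the discrete sigma-algebra. *)
HB.instance Definition _ := isPointed.Build freeprod 1%g.
HB.instance Definition _ := @isMeasurable.Build default_measure_display
  freeprod discrete_measurable discrete_measurable0
  discrete_measurableC discrete_measurableU.

Definition fp_letter (u : letter) : freeprod := @FreeProd [:: u] isT.

(* The canonical embeddings of the two factors. *)
Definition fp_inl (x : G1) : freeprod :=
  if insub x is Some u then fp_letter (inl u) else 1%g.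
Definition fp_inr (x : G2) : freeprod :=
  if insub x is Some u then fp_letter (inr u) else 1%g.

Lemma fp_inlM : {morph fp_inl : x y / (x * y)%g}.
Proof.
move=> x y; apply: val_inj; rewrite /fp_inl.
have [x' _ xE|/negbNE/eqP ->] := insubP _ x; last by rewrite mul1g [in RHS]mul1g.
have [y' _ yE|/negbNE/eqP ->] := insubP _ y; last first.
  by rewrite mulg1 [in RHS]mulg1 -xE valK.
by rewrite -xE -yE /=; case: insubP.
Qed.

Lemma fp_inrM : {morph fp_inr : x y / (x * y)%g}.
Proof.
move=> x y; apply: val_inj; rewrite /fp_inr.
have [x' _ xE|/negbNE/eqP ->] := insubP _ x; last by rewrite mul1g [in RHS]mul1g.
have [y' _ yE|/negbNE/eqP ->] := insubP _ y; last first.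
  by rewrite mulg1 [in RHS]mulg1 -xE valK.
by rewrite -xE -yE /=; case: insubP.
Qed.

Lemma prod_normal w (nw : normal w) :
  \big[*%g/1%g]_(u <- w) fp_letter u = FreeProd nw.
Proof.
apply: val_inj => /=; elim: w nw => [|u w IH] nw; first by rewrite big_nil.
rewrite big_cons /= (IH (normal_behead nw)).
have := word_mulw1 nw; rewrite /word_mul /= -/(word_mul w [::]) word_mulw1 //.
exact: normal_behead nw.
Qed.

Definition fp_length (g : freeprod) : nat := size (nform g).

Definition inf_normal (xi : nat -> letter) : Prop :=
  forall j, ~~ same_factor (xi j) (xi j.+1).

Definition infword := {xi : nat -> letter | inf_normal xi}.

(* An infinite word, needed because measurable types are inhabited. *)
Let witness (G : ntFinGroupType) : {x : G | x != 1%g} :=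
  Sub (xchoose (@ntg_subproof G)) (xchooseP (@ntg_subproof G)).

Lemma infword_point_subproof :
  inf_normal (fun n => if odd n then inl (witness G1) else inr (witness G2)).
Proof. by move=> j /=; case: odd. Qed.

HB.instance Definition _ := gen_eqMixin infword.
HB.instance Definition _ := gen_choiceMixin infword.
HB.instance Definition _ := isPointed.Build infword
  (exist inf_normal _ infword_point_subproof).

Definition cylinder (w : seq letter) : set infword :=
  [set xi | mkseq (proj1_sig xi) (size w) = w].

HB.instance Definition _ := @isMeasurable.Build (sigma_display (range cylinder))
  infword <<s range cylinder >>
  (@sigma_algebra0 _ setT (range cylinder)) (@sigma_algebraC _ (range cylinder))
  (@sigma_algebra_bigcup _ setT (range cylinder)).

Definition letterwise_cvg (g : nat -> freeprod) (xi : infword) : Prop :=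
  forall m, \forall n \near \oo, take m (nform (g n)) = mkseq (proj1_sig xi) m.

End FreeProduct.

Arguments fp_inl {G1} G2 x.
Arguments fp_inr G1 {G2} x.

Definition mutually_independent (R : realType) d d' (T : measurableType d)
    (T' : measurableType d') (P : probability T R)
    (x : nat -> {RV P >-> T'}) : Prop :=
  forall (J : seq nat) (A : nat -> set T'), uniq J ->
    (forall j, measurable (A j)) ->
    P (\bigcap_(j in [set` J]) x j @^-1` A j) =
    (\prod_(j <- J) P (x j @^-1` A j))%E.

Definition iid_of_law (R : realType) d d' (T : measurableType d)
    (T' : measurableType d') (P : probability T R) (mu : probability T' R)
    (x : nat -> {RV P >-> T'}) : Prop :=
  mutually_independent x /\
  forall n A, measurable A -> distribution P (x n) A = mu A.

Fixpoint walk (G : groupType) (T : Type) (x : nat -> T -> G) (n : nat) (t : T) : G :=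
  if n is m.+1 then (walk x m t * x m t)%g else 1%g.

Section RandomWalk.
Variables (R : realType) (G1 G2 : ntFinGroupType).
Let G := freeprod G1 G2.

Definition is_drift d (T : measurableType d) (P : probability T R)
    (x : nat -> {RV P >-> G}) (gamma : R) : Prop :=
  {ae P, forall t,
    (fp_length (walk x n t))%:R / n%:R @[n --> \oo] --> gamma}.

(* nu is the law of an almost sure letter-by-letter limit of the walk; the
   existence of that limit is part of the predicate. *)
Definition is_harmonic_measure d (T : measurableType d) (P : probability T R)
    (x : nat -> {RV P >-> G}) (nu : probability (infword G1 G2) R) : Prop :=
  exists Xoo : {RV P >-> infword G1 G2},
    {ae P, forall t, letterwise_cvg (fun n => walk x n t) (Xoo t)} /\
    forall A, measurable A -> nu A = distribution P Xoo A.

Definition mult_q (r : letter G1 G2 -> R) (u : letter G1 G2) : R :=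
  r u / \sum_(v | ~~ same_factor u v) r v.

Definition is_markov_mult (r : letter G1 G2 -> R)
    (nu : probability (infword G1 G2) R) : Prop :=
  [/\ forall u, 0 < r u < 1,
      \sum_u r u = 1 &
      forall w u, normal (rcons w u) ->
        nu (cylinder (rcons w u)) = ((\prod_(v <- w) mult_q r v) * r u)%:E].

End RandomWalk.

(* Only used on [0, 1], where the denominator does not vanish. *)
Fixpoint Gfun (R : realType) (n : nat) (x : R) : R :=
  match n with
  | 0 => 1 / 4 + x / 2
  | S n1 => match n1 with
            | 0 => x
            | S n2 => 8 * (1 - x) / (3 - 2 * x) * Gfun n1 x - Gfun n2 x
            end
  end.

(* Main.v *)
From HB Require Import structures.
From mathcomp Require Import all_boot all_order all_algebra all_fingroup.
From mathcomp Require Import all_solvable.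
From mathcomp Require Import all_classical all_reals all_analysis.
From mathcomp Require Import measurable_realfun ring lra.
Require Import Defs.

Set Implicit Arguments.
Unset Strict Implicit.
Unset Printing Implicit Defensive.

Import Order.TTheory GRing.Theory Num.Theory.
Import numFieldNormedType.Exports.

Local Open Scope classical_set_scope.
Local Open Scope ring_scope.

(* Write q(u) = r(u) / r(Sigma \ Sigma_u), extended multiplicatively to normal
   forms.  The recurrence for G_0, ..., G_(k-1) says exactly that
   g |-> q(g^-1 h) is harmonic for the walk except at h.
   - Drift: phi(g), the integral of |g xi| - |xi| against the multiplicative
     measure, is an explicit expression in q; it stays at bounded distance from
     |g| and grows by exactly gamma per step on average.  A fourth moment bound
     on the martingale phi(X_n) - n gamma gives |X_n| / n -> gamma > 0.  Since a
     step only affects the end of the normal form, X_n then converges letter by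
     letter.
   - Law of the limit: gluing two affine functions of q(g^-1 h), one inside and
     one outside the set of words with prefix h, yields a bounded harmonic
     function which along the walk tends to the indicator of
     "h is a prefix of X_oo" and whose value at 1 is the multiplicative measure
     of the cylinder of h.
   - The parameter: G_(n+2) = (2 + d) G_(n+1) - G_n with d = (2 - 4x) / (3 - 2x),
     and G_(k-1) = G_1 forces the symmetry G_(k-i) = G_i, hence
     G_1 = (1 - d s_k(d)) G_0 with s_(k+2) = 1 / (d + 1 / (1 + s_k)), s_0 = -1/2,
     s_1 = 0.  As s_k(d) decreases with d and increases with k, the equation
     s_k(d) = (3 - 2x) / (2 (1 + 2x)) has one root, monotone in k, which tends to
     1/6. *)

(** * Symmetric solutions of the recurrence *)

Section SymmetricRecurrence.
Variable R : realFieldType.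
Implicit Types (c d u v : R) (k n : nat).

Fixpoint linrec c u v n : R := if n is n'.+1 then linrec c v (c * v - u) n' else u.

Lemma linrecSS c u v n :
  linrec c u v n.+2 = c * linrec c u v n.+1 - linrec c u v n.
Proof. by elim: n u v => // n IH u v; rewrite [LHS]IH. Qed.

Lemma linrec_linear c u u' v n :
  linrec c u v n = linrec c u' v n + (u - u') * linrec c 1 0 n.
Proof.
suff H : forall a b a' b' l, linrec c (a' + l * a) (b' + l * b) n =
    linrec c a' b' n + l * linrec c a b n.
  by rewrite -H; congr (linrec _ _ _ _); ring.
elim: n => [//|n IH] a b a' b' l /=.
by rewrite -IH; congr (linrec _ _ _ _); ring.
Qed.

(** The increments of the sequence change by [d] times the current term, so from [1, 0, -1] on it
    falls by at least one at each step. In particular it does not vanish, which gives uniqueness in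
    [linrec_sym_uniq]. *)
Lemma linrec10_neg d n : 0 <= d -> linrec (2 + d) 1 0 n.+2 <= -1.
Proof.
move=> d0.
suff /(_ n)/andP[] : forall n, (linrec (2 + d) 1 0 n.+2 <= -1) &&
    (linrec (2 + d) 1 0 n.+2 <= linrec (2 + d) 1 0 n.+1) by [].
elim=> [|m /andP[h1 h2]]; first by rewrite /=; apply/andP; split; lra.
by rewrite linrecSS; apply/andP; split; nra.
Qed.

(* [1 - d * gap k d] is the ratio of the second to the first term of the solution
   symmetric under [i |-> k - i]; the value at [0] is the one that makes the
   recursion in steps of two valid for [k = 2]. *)
Fixpoint gap k d : R :=
  match k with
  | 0 => - 2^-1
  | 1 => 0
  | k'.+2 => (d + (1 + gap k' d)^-1)^-1
  end.

Lemma gap_gtN k d : 0 <= d -> - 2^-1 <= gap k d.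
Proof.
move=> d0; elim/ltn_ind: k => -[|[|k]] IH; [by []| |]; rewrite /=.
  lra.
have h : -2^-1 <= gap k d by exact: IH.
apply: (@le_trans _ _ 0); first lra.
by rewrite invr_ge0 addr_ge0 // invr_ge0; lra.
Qed.

Lemma gap1_gt0 k d : 0 <= d -> 0 < 1 + gap k d.
Proof. by move=> /(gap_gtN k) ?; lra. Qed.

Lemma gap_den_gt0 k d : 0 <= d -> 0 < d + (1 + gap k d)^-1.
Proof. by move=> d0; rewrite ltr_wpDl // invr_gt0 gap1_gt0. Qed.

Lemma gap_gt0 k d : 0 <= d -> (2 <= k)%N -> 0 < gap k d.
Proof. by case: k => [|[|k]] // d0 _; rewrite /= invr_gt0 gap_den_gt0. Qed.

(** This is the ratio [v / u] that solves [(2 + d) * v - u = (1 - d * gap k d) * v]: a solution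
    symmetric under [i |-> k + 2 - i] must stay symmetric once both end terms are dropped. *)
Lemma gapSS k d : 0 <= d ->
  1 - d * gap k.+2 d = (1 + d * (1 + gap k d))^-1.
Proof.
move=> d0; have h := gap1_gt0 k d0.
have h2 : 0 < 1 + d * (1 + gap k d) by nra.
have h3 : d + (1 + gap k d)^-1 = (1 + d * (1 + gap k d)) / (1 + gap k d).
  by field; lra.
by rewrite /= h3; field; rewrite !gt_eqF.
Qed.

(** The map [s |-> (d + (1 + s)^-1)^-1] increases with [s] and decreases with [d], so the order
    passes through each double step. *)
Lemma gap_antitone k d d' : 0 <= d -> d <= d' -> gap k d' <= gap k d.
Proof.
move=> d0 excess'; have d'0 := le_trans d0 excess'.
elim/ltn_ind: k => -[|[|k]] IH //=.
have h := gap1_gt0 k d0; have h' := gap1_gt0 k d'0.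
rewrite lef_pV2 ?posrE ?gap_den_gt0 //.
by rewrite lerD // lef_pV2 ?posrE // lerD2l IH.
Qed.

Lemma gap_ltS k d : 0 <= d -> gap k d < gap k.+1 d.
Proof.
(* Two consecutive inequalities are carried along because [gap] recurses in steps of two. *)
move=> d0; suff /andP[//] : (gap k d < gap k.+1 d) && (gap k.+1 d < gap k.+2 d).
elim: k => [|k /andP[h1 h2]].
  rewrite /= invr_gt0; apply/andP; split; first lra.
  have : 0 < (1 + - 2^-1 : R)^-1 by rewrite invr_gt0; lra.
  lra.
have H i j : gap i d < gap j d -> gap i.+2 d < gap j.+2 d.
  have hi := gap1_gt0 i d0; have hj := gap1_gt0 j d0.
  move=> ij /=; rewrite ltf_pV2 ?posrE ?gap_den_gt0 //.
  by rewrite ltrD2l ltf_pV2 ?posrE // ltrD2l.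
by rewrite h2 andTb; exact: (H k k.+1).
Qed.

Lemma gap_lt k l d : 0 <= d -> (k < l)%N -> gap k d < gap l d.
Proof.
move=> d0; elim: l => // l IH; rewrite ltnS leq_eqVlt => /predU1P[->|/IH h].
  exact: gap_ltS.
exact: lt_trans h (gap_ltS _ d0).
Qed.

Lemma gap_lt_inv k d : 0 < d -> gap k d < d^-1.
Proof.
move=> d0; case: k => [|[|k]] /=.
- by have := invr_gt0 d; rewrite d0; lra.
- by rewrite invr_gt0.
- by rewrite ltf_pV2 ?posrE ?gap_den_gt0 ?ltW // ltrDl invr_gt0 gap1_gt0 // ltW.
Qed.

(** At [d = 0] a double step adds one. *)
Lemma gap0E k : gap k 0 = (k%:R - 1) / 2.
Proof.
elim/ltn_ind: k => -[|[|k]] IH /=; [lra|lra|].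
by rewrite add0r invrK IH // -[k.+2]addn2 natrD; lra.
Qed.

(** Induction in steps of two: the terms of indices 1 to [k + 1] again start with the ratio
    [1 - d * gap k d], by [vE], so they are symmetric by the induction hypothesis. *)
Lemma linrec_sym k d u : 0 <= d ->
  forall i, (i <= k)%N ->
  linrec (2 + d) u ((1 - d * gap k d) * u) (k - i) =
  linrec (2 + d) u ((1 - d * gap k d) * u) i.
Proof.
move=> d0; elim/ltn_ind: k u => -[|[|k]] IH u i.
- by rewrite leqn0 => /eqP->.
- by case: i => [|[|i]] //= _; rewrite mulr0 subr0 mul1r.
rewrite gapSS //; have h := gap1_gt0 k d0.
set v := _ * u.
have ht : 0 < 1 + d * (1 + gap k d) by nra.
have vE : (2 + d) * v - u = (1 - d * gap k d) * v.
  by rewrite /v; field; rewrite gt_eqF.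
have S j : (j <= k)%N -> linrec (2 + d) u v (k - j).+1 = linrec (2 + d) u v j.+1.
  by move=> jk /=; rewrite vE IH.
(* The end term follows by running the recurrence one step past the inner terms. For [k = 0] there
   is a single inner term, and the value [gap 0 d = - 2^-1] is what closes the computation. *)
have S2 : linrec (2 + d) u v k.+2 = u.
  rewrite linrecSS; case: (posnP k) => [k0|k0].
    move: ht; rewrite k0 /= vE /v k0 /= => ht.
    by field; rewrite !gt_eqF //; lra.
  have := S 0%N isT; rewrite subn0 => ->; have := S 1%N k0.
  by rewrite subn1 prednK // => ->; rewrite /=; ring.
case: i => [_|i]; first by rewrite subn0 S2.
rewrite ltnS leq_eqVlt => /predU1P[->|]; first by rewrite subnn S2.
by rewrite ltnS => ik; rewrite subSS subSn // S.
Qed.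

(** The symmetric solution with second term [v] also takes the value [v] at [k - 1]. By linearity
    the two solutions differ there by [u - u'] times a nonzero number, hence [u = u']. *)
Lemma linrec_sym_uniq k d u v : 0 <= d -> (3 <= k)%N ->
  linrec (2 + d) u v k.-1 = v -> v = (1 - d * gap k d) * u.
Proof.
case: k => [|[|[|k]]] //= d0 _ E.
have h := gap1_gt0 k.+1 d0.
have ht : 0 < 1 + d * (1 + gap k.+1 d) by nra.
(* The first term for which [v] is the second term of the symmetric solution. *)
pose u' := (1 + d * (1 + gap k.+1 d)) * v.
have vE : (1 - d * gap k.+3 d) * u' = v.
  by rewrite gapSS // /u' mulrA mulVf ?mul1r // gt_eqF.
have := @linrec_sym k.+3 d u' d0 1%N isT.
rewrite vE (_ : (k.+3 - 1 = k.+2)%N); last by rewrite subn1.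
have := linrec_linear (2 + d) u u' v k.+2; rewrite [LHS]E => {}E E'.
move: E; rewrite E' => /eqP; rewrite -subr_eq0 /= opprD addrA subrr add0r oppr_eq0 mulf_eq0.
have := linrec10_neg k d0; rewrite /= => hn /orP[|/eqP e0]; last by lra.
by rewrite subr_eq0 => /eqP ->; rewrite [RHS]vE.
Qed.

Lemma rho_bound k d : 0 < d -> (2 <= k)%N -> 0 < 1 - d * gap k d < 1.
Proof.
move=> d0 k2; have s0 := gap_gt0 (ltW d0) k2; apply/andP; split; last by nra.
case: k k2 {s0} => [|[|k]] // _; rewrite gapSS ?ltW // invr_gt0.
by have h := gap1_gt0 k (ltW d0); nra.
Qed.

(** Both end terms are dropped again: the inner terms are at most their own end value [t * u], and
    [0 < t < 1]. *)
Lemma linrec_bound k d u : 0 < d -> 0 < u ->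
  forall i, (0 < i < k)%N ->
  0 < linrec (2 + d) u ((1 - d * gap k d) * u) i < u.
Proof.
move=> d0; elim/ltn_ind: k u => -[|[|k]] IH u u0 i; [by case: i|by case: i => [|[]]|].
case: i => // i /andP[_]; rewrite !ltnS => ik.
have /andP[r0 r1] : 0 < 1 - d * gap k.+2 d < 1 by exact: rho_bound.
move: (r0) (r1); rewrite gapSS ?ltW //; have h := gap1_gt0 k (ltW d0).
set t := _^-1 => t0 t1.
have ht : 0 < 1 + d * (1 + gap k d) by nra.
have vE : (2 + d) * (t * u) - u = (1 - d * gap k d) * (t * u).
  by rewrite /t; field; rewrite gt_eqF.
have tu : 0 < t * u < u by apply/andP; split; nra.
have lt_trans_tu x : 0 < x <= t * u -> 0 < x < u.
  by case/andP: tu => _ + /andP[-> ]; move=> /[swap]; exact: le_lt_trans.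
rewrite [linrec _ _ _ _]/= vE; apply: lt_trans_tu; case/andP: tu => tu _.
move: ik; rewrite leq_eqVlt => /predU1P[->|ik].
  by rewrite -[X in linrec _ _ _ X]subn0 (linrec_sym _ (ltW d0)) //= tu lexx.
case: (posnP i) => [->|i0]; first by rewrite /= tu lexx.
by have /andP[-> /ltW ->] := IH k (ltnW (ltnSn _)) _ tu i (introT andP (conj i0 ik)).
Qed.

End SymmetricRecurrence.

(** * The equation for the parameter: existence, uniqueness, monotonicity and limit *)

Section Gfun_fixpoint.
Variable R : realType.
Implicit Types (x : R) (k n : nat).

(** [2 + excess x] is the coefficient in the recurrence of [Gfun], and [target x] is the value of
    the gap for which the ratio of [Gfun 1 x] to [Gfun 0 x] is that of a symmetric solution. *)
Definition excess x : R := (2 - 4 * x) / (3 - 2 * x).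
Definition target x : R := (3 - 2 * x) / (2 * (1 + 2 * x)).

Lemma GfunE n x : x < 3 / 2 ->
  Gfun n x = linrec (2 + excess x) (1 / 4 + x / 2) x n.
Proof.
move=> xlt; elim/ltn_ind: n => -[|[|n]] IH //.
rewrite linrecSS -!IH //= /excess; congr (_ * _ - _).
by field; rewrite gt_eqF //; lra.
Qed.

Lemma excess_ge0 x : x <= 1 / 2 -> 0 <= excess x.
Proof. by move=> ?; rewrite divr_ge0 //; lra. Qed.

Lemma excess_gt0 x : x < 1 / 2 -> 0 < excess x.
Proof. by move=> ?; rewrite divr_gt0 //; lra. Qed.

Lemma excess_antitone x x' : x <= x' -> x' <= 1 / 2 -> excess x' <= excess x.
Proof.
move=> xx' h; rewrite /excess ler_pdivrMr; last lra.
by rewrite mulrAC ler_pdivlMr; lra.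
Qed.

Lemma target_lt x x' : 0 <= x -> x < x' -> x' <= 1 / 2 -> target x' < target x.
Proof.
move=> x0 xx' h; rewrite /target ltr_pdivrMr; last lra.
by rewrite mulrAC ltr_pdivlMr; lra.
Qed.

Lemma gap_target k x : 0 < x < 1 / 2 ->
  (gap k (excess x) = target x) <-> (x = (1 - excess x * gap k (excess x)) * (1 / 4 + x / 2)).
Proof.
move=> /andP[x0 x1]; have d0 := excess_gt0 x1.
have E : (1 - excess x * target x) * (1 / 4 + x / 2) = x.
  by rewrite /excess /target; field; rewrite !gt_eqF //; lra.
split=> [->|xE]; first by rewrite E.
have {}E : excess x * (1 / 4 + x / 2) * (gap k (excess x) - target x) = 0 by lra.
apply/eqP; rewrite -subr_eq0; move/eqP: E; rewrite mulf_eq0 => /orP[|//].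
rewrite mulf_eq0 (gt_eqF d0) (_ : (1 / 4 + x / 2 == 0) = false) //.
by rewrite gt_eqF //; lra.
Qed.

Lemma Gfun_rec k x : (3 <= k)%N -> 0 < x < 1 / 2 -> Gfun k.-1 x = x ->
  x = (1 - excess x * gap k (excess x)) * (1 / 4 + x / 2).
Proof.
move=> k3 /andP[x0 x1]; rewrite GfunE; last lra.
by apply: linrec_sym_uniq => //; apply: excess_ge0; lra.
Qed.

Lemma Gfun_fixP k x : (3 <= k)%N -> 0 < x < 1 / 2 ->
  Gfun k.-1 x = x <-> gap k (excess x) = target x.
Proof.
move=> k3 x01; split=> [E|/(gap_target _ x01) E].
  by apply/(gap_target _ x01)/Gfun_rec.
have /andP[x0 x1] := x01.
rewrite GfunE; last lra.
have := @linrec_sym _ k (excess x) (1 / 4 + x / 2) (excess_ge0 (ltW x1)) 1%N.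
by rewrite -E subn1; apply; apply: leq_trans k3.
Qed.

Lemma Gfun_sym k x i : (3 <= k)%N -> 0 < x < 1 / 2 -> Gfun k.-1 x = x ->
  (i <= k)%N -> Gfun (k - i) x = Gfun i x.
Proof.
move=> k3 x01 /(Gfun_rec k3 x01) E ik; have /andP[x0 x1] := x01.
rewrite !GfunE; [|lra|lra].
by have := linrec_sym (1 / 4 + x / 2) (excess_ge0 (ltW x1)) ik; rewrite -E.
Qed.

Lemma Gfun_bound k x i : (3 <= k)%N -> 0 < x < 1 / 2 -> Gfun k.-1 x = x ->
  (0 < i < k)%N -> 0 < Gfun i x < Gfun 0 x.
Proof.
move=> k3 x01 /(Gfun_rec k3 x01) E ik; have /andP[x0 x1] := x01.
rewrite !GfunE; [|lra|lra].
have u0 : 0 < 1 / 4 + x / 2 by lra.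
by have := linrec_bound (excess_gt0 x1) u0 ik; rewrite -E.
Qed.

(** The total mass of [r]. By the recurrence [excess x * Gfun i x] is a second difference, so its
    sum telescopes; the symmetry turns the boundary terms into
    [2 * Gfun 0 x - 2 * x = 1 / 2 - x]. *)
Lemma Gfun_sum k x : (3 <= k)%N -> 0 < x < 1 / 2 -> Gfun k.-1 x = x ->
  Gfun 0 x + \sum_(1 <= i < k) Gfun i x = 1.
Proof.
move=> k3 x01 E; have /andP[x0 x1] := x01.
have E0 : Gfun k x = Gfun 0 x by rewrite -(Gfun_sym k3 x01 E (leq0n k)) subn0.
have H n : (2 + excess x - 2) * \sum_(1 <= i < n.+1) Gfun i x =
    Gfun 0 x + Gfun n.+1 x - Gfun 1 x - Gfun n x.
  elim: n => [|n IH]; first by rewrite big_geq //; lra.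
  rewrite big_nat_recr // [LHS]mulrDr IH.
  have -> : Gfun n.+2 x = (2 + excess x) * Gfun n.+1 x - Gfun n x.
    by rewrite !GfunE ?linrecSS; lra.
  ring.
have := H k.-1; rewrite prednK; last exact: leq_trans k3.
rewrite E E0 [Gfun 1 x]/= [Gfun 0 x]/= => {}H.
have {H} : excess x * \sum_(1 <= i < k) Gfun i x = 1 / 2 - x by lra.
move: (\sum_(1 <= i < k) _) => S H.
have d0 := excess_gt0 x1.
suff -> : S = (1 / 2 - x) / excess x by rewrite /excess; field; rewrite !gt_eqF //; lra.
by rewrite -H mulrC mulKf // gt_eqF.
Qed.

Lemma gap_excess_continuous k x : x < 1 / 2 + 1 / 2 -> 0 <= excess x ->
  {for x, continuous (fun z => gap k (excess z))}.
Proof.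
move=> x1 d0.
have cexcess : {for x, continuous excess}.
  apply: cvgM; first by apply: cvgB; [exact: cvg_cst|apply: cvgM; [exact: cvg_cst|exact: cvg_id]].
  apply: cvgV; first by rewrite gt_eqF //; lra.
  by apply: cvgB; [exact: cvg_cst|apply: cvgM; [exact: cvg_cst|exact: cvg_id]].
elim/ltn_ind: k => -[|[|k]] IH; [exact: cvg_cst|exact: cvg_cst|].
apply: cvgV; first by rewrite gt_eqF // gap_den_gt0.
apply: cvgD => //; apply: cvgV; first by rewrite gt_eqF // gap1_gt0.
by apply: cvgD; [exact: cvg_cst|exact: IH].
Qed.

Lemma target_continuous x : 0 <= x -> {for x, continuous target}.
Proof.
move=> x0; apply: cvgM.
  by apply: cvgB; [exact: cvg_cst|apply: cvgM; [exact: cvg_cst|exact: cvg_id]].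
apply: cvgV; first by rewrite gt_eqF //; lra.
apply: cvgM; first exact: cvg_cst.
by apply: cvgD; [exact: cvg_cst|apply: cvgM; [exact: cvg_cst|exact: cvg_id]].
Qed.

(** Intermediate values: at 0 the target equals [(excess 0)^-1], which the gap stays below; at
    [1 / 2] the excess vanishes and the gap is [(k - 1) / 2], above the target [1 / 2] as soon as
    [k] is at least 3. *)
Lemma gap_target_exists k : (3 <= k)%N ->
  exists x, 0 < x < 1 / 2 /\ gap k (excess x) = target x.
Proof.
move=> k3; pose f x := gap k (excess x) - target x.
have f0 : f 0 < 0.
  rewrite /f subr_lt0; have -> : target 0 = (excess 0)^-1 by rewrite /target /excess; field.
  by apply/gap_lt_inv/excess_gt0; lra.
have f1 : 0 < f (1 / 2).
  rewrite /f subr_gt0 (_ : excess (1 / 2) = 0); last by rewrite /excess; field.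
  rewrite (_ : target (1 / 2) = 1 / 2); last by rewrite /target; field.
  rewrite gap0E; have : (3%:R : R) <= k%:R by rewrite ler_nat.
  by lra.
have [x] : exists2 x, x \in `[0, 1 / 2] & f x = 0.
  apply: IVT; [lra| |by rewrite ge_min le_max (ltW f0) (ltW f1) orbT].
  apply: continuous_in_subspaceT => x; rewrite inE /= in_itv /= => /andP[x0 x1].
  apply: cvgB; last exact: target_continuous.
  by apply: gap_excess_continuous; [lra|exact: excess_ge0].
rewrite in_itv /= => /andP[x0 x1] fx.
exists x; split; last by move/eqP: fx; rewrite subr_eq0 => /eqP.
rewrite !lt_neqAle x0 x1 !andbT; apply/andP; split; apply/eqP => E.
  by move: f0; rewrite [in f _]E fx ltxx.
by move: f1; rewrite -E fx ltxx.
Qed.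

(** As [x] grows, [target x] strictly decreases while [gap k (excess x)] does not decrease. *)
Lemma gap_target_inj k x x' : 0 <= x <= 1 / 2 -> 0 <= x' <= 1 / 2 ->
  gap k (excess x) = target x -> gap k (excess x') = target x' -> x = x'.
Proof.
wlog : x x' / x < x' => [H h h' E E'|xx'].
  by case: (ltgtP x x') => // xx'; [exact: H|apply/esym/H].
move=> /andP[x0 x1] /andP[y0 y1] E E'.
have := target_lt x0 xx' y1; rewrite -E -E' ltNge => /negP[].
by apply: gap_antitone; [exact: excess_ge0|exact/excess_antitone/y1/ltW].
Qed.

(** A larger index raises the nondecreasing curve [gap k (excess x)], so its crossing with the
    decreasing [target] moves to the left. *)
Lemma gap_target_lt k l x x' : (k < l)%N -> 0 <= x <= 1 / 2 -> 0 <= x' <= 1 / 2 ->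
  gap k (excess x) = target x -> gap l (excess x') = target x' -> x' < x.
Proof.
move=> kl /andP[x0 x1] /andP[y0 y1] E E'; rewrite ltNge; apply/negP => xx'.
have : target x' <= target x.
  move: xx'; rewrite le_eqVlt => /predU1P[->//|xx'].
  exact/ltW/target_lt.
rewrite -E -E' leNgt => /negP[]; apply: (lt_le_trans (gap_lt _ kl)).
  exact: excess_ge0.
by apply: gap_antitone; [exact: excess_ge0|exact/excess_antitone].
Qed.

Lemma excess_sixth : excess (1 / 6) = 1 / 2. Proof. by rewrite /excess; field. Qed.

(** At [d = 1 / 2] the double step has fixed point 1 and divides the distance [1 - s] by [3 + s],
    hence at least by 2. The rate [4 / k.+2%:R] is crude but sufficient. *)
Lemma gap_half k : 1 - 4 / k.+2%:R <= gap k (1 / 2 : R) < 1.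
Proof.
elim/ltn_ind: k => -[|[|k]] IH; [by rewrite /=; lra|by rewrite /=; lra|].
have /andP[h1 h2] : 1 - 4 / k.+2%:R <= gap k (1 / 2 : R) < 1 by exact: IH.
have h3 := @gap_gtN _ k (1 / 2 : R) ltac:(lra).
have -> : gap k.+2 (1 / 2 : R) = 1 - (1 - gap k (1 / 2)) / (3 + gap k (1 / 2)).
  by rewrite /=; field; rewrite !gt_eqF //; lra.
move: (gap k _) h1 h2 h3 => s h1 h2 h3.
have p0 : 0 < (1 - s) / (3 + s) by rewrite divr_gt0 //; lra.
apply/andP; split; last lra.
suff : (1 - s) / (3 + s) <= 4 / k.+4%:R by move: (4 / k.+4%:R) => e; lra.
have n1 : 0 < (k.+2%:R : R) by rewrite ltr0n.
have n2 : 0 < (k.+4%:R : R) by rewrite ltr0n.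
have nE : k.+4%:R = k.+2%:R + 2 :> R by rewrite -natrD addn2.
have n3 : (2 : R) <= k.+2%:R by rewrite ler_nat.
have {}h1 : 1 - s <= 4 / k.+2%:R by move: (4 / k.+2%:R) h1 => e; lra.
apply: (@le_trans _ _ (4 / k.+2%:R / 2)).
  apply: (@le_trans _ _ ((1 - s) / 2)); last by rewrite ler_pM2r // invr_gt0.
  rewrite ler_pM2l; last lra.
  by rewrite lef_pV2 ?posrE //; lra.
rewrite -mulrA ler_pM2l ?ltr0n // -invfM lef_pV2 ?posrE ?mulr_gt0 //.
by rewrite nE; move: (k.+2%:R) n3 => e; lra.
Qed.

(** The point [1 / 6] is where the excess is [1 / 2] and the target is 1, the limit of
    [gap k (1 / 2)]. Monotonicity in [x] transfers the estimate of [gap_half] to the root. *)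
Lemma gap_target_near k x : 0 < x < 1 / 2 -> gap k (excess x) = target x ->
  1 / 6 < x <= 1 / 6 + 8 / 3 / k.+2%:R.
Proof.
move=> /andP[x0 x1] E; have /andP[s1 s2] := gap_half k.
have x6 : 1 / 6 < x.
  rewrite ltNge; apply/negP => x6.
  have := gap_antitone k (excess_ge0 (ltac:(lra) : 1 / 6 <= 1 / 2)) (excess_antitone x6 ltac:(lra)).
  rewrite E excess_sixth => h; have : 1 <= target x; last lra.
  by rewrite /target ler_pdivlMr; lra.
rewrite x6 /=.
have : 1 - 4 / k.+2%:R <= target x.
  rewrite -E; apply: le_trans s1 _; rewrite -excess_sixth; apply: gap_antitone.
    by apply: excess_ge0; lra.
  by apply: excess_antitone; lra.
have n1 : 0 <= (k.+2%:R^-1 : R) by rewrite invr_ge0 ler0n.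
rewrite /target ler_pdivlMr; last lra.
move: (k.+2%:R^-1) n1 => e e0; nra.
Qed.

End Gfun_fixpoint.

(** * Words in a free product *)

Section FreeProductWords.
Variables G1 G2 : ntFinGroupType.
Local Notation letter := (letter G1 G2).
Local Arguments normal : simpl never.
Local Notation fp := (freeprod G1 G2).
Implicit Types (u v s : letter) (w z : seq letter) (g h : fp) (xi : infword G1 G2).

Lemma nform_inj : injective (@nform G1 G2).
Proof. exact: val_inj. Qed.

Lemma nformM g h : nform (g * h)%g = word_mul (nform g) (nform h).
Proof. by []. Qed.

Lemma nformV g : nform g^-1%g = word_inv (nform g).
Proof. by []. Qed.

Lemma fp_letterV u : (fp_letter u)^-1%g = fp_letter (letter_inv u).
Proof. exact: nform_inj. Qed.

Lemma same_factor_refl u : same_factor u u.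
Proof. by case: u. Qed.

Lemma same_factor_invr u v : same_factor u (letter_inv v) = same_factor u v.
Proof. by case: u; case: v. Qed.

Lemma normal_cat_letter u w z :
  normal (rcons w u ++ z) =
  normal (rcons w u) && (if z is v :: _ then ~~ same_factor u v else true) && normal z.
Proof.
rewrite /normal; case: w => [|x w] /=; first by case: z => [|v z]; rewrite ?andbT.
rewrite cat_path last_rcons -andbA; congr (_ && _).
by case: z.
Qed.

Lemma word_mul_cat w z : normal (w ++ z) -> word_mul w z = w ++ z.
Proof.
elim: w => //= u w IH nw; rewrite /word_mul /= -/(word_mul w z) IH; last first.
  exact: normal_behead nw.
move: nw; rewrite normal_cons; case: (w ++ z) => //= v t /andP[nuv _].
by rewrite letter_mul_diff.
Qed.

Lemma word_mul_rcons w u z :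
  word_mul (rcons w u) z = word_mul w (letter_act u z).
Proof. by rewrite /word_mul -cats1 foldr_cat. Qed.

Lemma word_mul_rcons1 w u s : normal (rcons w u) ->
  word_mul (rcons w u) [:: s] = w ++ letter_mul u s.
Proof.
move=> nw; rewrite word_mul_rcons /= cats0 word_mul_cat //.
have [sus|nus] := boolP (same_factor u s); last first.
  by rewrite letter_mul_diff // -cat_rcons normal_cat_letter nw nus.
have sE t : same_factor s t -> same_factor u t.
  by rewrite (same_factor_trans _ sus).
have := nw; rewrite -cats1; case/lastP: w nw => [|w x] nw.
  by have [->|[t ->]] := letter_mul_same sus.
have [->|[t -> /sE sut]] := letter_mul_same sus; rewrite !normal_cat_letter.
  by rewrite /= => /andP[/andP[-> _]].
by rewrite /= same_factor_sym (same_factor_trans _ sut) same_factor_sym.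
Qed.

(** Right multiplication by a letter can change or delete only the last letter, or append one; the
    strict inequality keeps the prefix clear of it. *)
Lemma take_mul_letter m g s : (m < size (nform g))%N ->
  take m (nform (g * fp_letter s)%g) = take m (nform g).
Proof.
rewrite nformM /=; case/lastP: (nform g) (nformP g) => // w u nw.
rewrite size_rcons ltnS => mw.
by rewrite word_mul_rcons1 // -cats1 !takel_cat.
Qed.

Lemma size_letter_act u w : (size (letter_act u w) <= (size w).+1)%N.
Proof.
case: w => //= v w; rewrite size_cat.
have [suv|nuv] := boolP (same_factor u v); last by rewrite letter_mul_diff.
by have [->|[t -> _]] := letter_mul_same suv; rewrite ?addn1 //= ?ltnS leqW.
Qed.

Lemma size_word_mul w z : (size (word_mul w z) <= size w + size z)%N.
Proof.
elim: w => //= u w IH; rewrite addSn.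
by apply: leq_trans (size_letter_act _ _) _; rewrite ltnS.
Qed.

Lemma fp_lengthV g : fp_length g^-1%g = fp_length g.
Proof. by rewrite /fp_length nformV size_rev size_map. Qed.

Lemma fp_lengthM_ge g h : (fp_length g <= fp_length (g^-1 * h)%g + fp_length h)%N.
Proof.
rewrite -fp_lengthV -(fp_lengthV h).
have E : (g^-1 = (g^-1 * h) * h^-1)%g by rewrite -mulgA mulgV mulg1.
by rewrite [X in (fp_length X <= _)%N]E; exact: size_word_mul.
Qed.

(* With [u] the last letter of [h], applied to the word [z] of [g^-1 * h]: tells
   whether [h] is a prefix of [g]. *)
Definition beyond u z : bool := if z is v :: z' then ~~ same_factor u (last v z') else true.

(** If [g] is [h] followed by a word [t], then [g^-1 * h] has the word of the inverse of [t], whose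
    last letter is the inverse of the first letter of [t] and so lies outside the factor of [u]. *)
Lemma take_beyond w u g (h : fp) : nform h = rcons w u ->
  (take (size w).+1 (nform g) == rcons w u) = beyond u (nform (g^-1 * h)%g).
Proof.
move=> hE; apply/eqP/idP => [E|].
  have gE := cat_take_drop (size w).+1 (nform g).
  move: (drop _ _) gE; rewrite E => t gE.
  have nt : normal (rcons w u ++ t) by rewrite gE; exact: nformP.
  have nt' : normal t by move: nt; rewrite normal_cat_letter => /andP[].
  have -> : (g^-1 * h)%g = (FreeProd nt')^-1%g.
    have -> : g = (h * FreeProd nt')%g.
      by apply: nform_inj; rewrite nformM hE /= word_mul_cat.
    by rewrite invMg -mulgA mulVg mulg1.
  rewrite nformV /=; move: nt; rewrite normal_cat_letter => /andP[/andP[_ +] _].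
  case: t {gE nt'} => // v t nuv; rewrite /word_inv /= rev_cons.
  have : last v (rcons (rev (map (@letter_inv G1 G2) t)) (letter_inv v)) = letter_inv v.
    by rewrite last_rcons.
  case: (rcons _ _) (size_rcons (rev [seq letter_inv i | i <- t]) (letter_inv v)) => //= y z _ ->.
  by rewrite same_factor_invr.
(* Conversely, [beyond] says that no reduction occurs in the product of [h] with the inverse of
   [g^-1 * h], which is [g]. *)
have gE : g = (h * (g^-1 * h)^-1)%g by rewrite invMg invgK mulgA mulgV mul1g.
move: (g^-1 * h)%g gE => z -> bz.
have nhz : normal (rcons w u ++ nform z^-1%g).
  rewrite normal_cat_letter nformP -hE nformP andbT /=.
  move: bz; rewrite /beyond; case: (nform z) => // v t.
  by rewrite /word_inv lastI map_rcons rev_rcons /= same_factor_invr.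
by rewrite nformM hE word_mul_cat // take_size_cat // size_rcons.
Qed.

(** Once the length exceeds [m] for good, from time [N m] on, steps no longer reach the first [m]
    letters; letter [j] of the limit is therefore read off at time [N j.+1]. *)
Lemma letterwise_cvg_walk (g : nat -> fp) :
  (forall n, exists s, g n.+1 = (g n * fp_letter s)%g) ->
  (forall m, \forall n \near \oo, (m <= fp_length (g n))%N) ->
  exists xi, letterwise_cvg g xi.
Proof.
move=> gS gl.
have /choice[N NP] : forall m, exists N, forall n, (N <= n)%N ->
    (m < fp_length (g n))%N.
  by move=> m; have [N _ H] := gl m.+1; exists N => n Nn; exact: H.
have tk m n : (N m <= n)%N -> take m (nform (g n)) = take m (nform (g (N m))).
  elim: n => [|n IH]; first by rewrite leqn0 => /eqP ->.
  rewrite leq_eqVlt => /predU1P[->//|]; rewrite ltnS => Nn; rewrite -IH //.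
  by have [s ->] := gS n; rewrite take_mul_letter //; exact: NP.
pose u0 : letter := proj1_sig (point : infword G1 G2) 0%N.
pose f j := nth u0 (nform (g (N j.+1))) j.
have fE j n : (N j.+1 <= n)%N -> f j = nth u0 (nform (g n)) j.
  by move=> Nn; rewrite -(nth_take u0 (ltnSn j)) tk // nth_take.
have nf : inf_normal f.
  move=> j; pose n := maxn (N j.+1) (N j.+2).
  rewrite (fE j n) ?leq_maxl // (fE j.+1 n) ?leq_maxr //.
  have := nformP (g n); rewrite /normal => /(sortedP u0); apply.
  have := NP j.+2 n (leq_maxr _ _); rewrite /fp_length => h; exact: ltn_trans h.
exists (exist _ f nf) => m; exists (\max_(j < m.+1) N j) => // n /= Mn.
have Nn j : (j <= m)%N -> (N j <= n)%N.
  move=> jm; apply: leq_trans Mn.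
  exact: (leq_bigmax (Ordinal (jm : j < m.+1)%N)).
have sz : size (take m (nform (g n))) = m.
  by rewrite size_takel // ltnW //; exact: NP (Nn _ _).
apply: (@eq_from_nth _ u0); rewrite sz ?size_mkseq // => i im.
by rewrite nth_take // nth_mkseq //= -fE // Nn.
Qed.

End FreeProductWords.

(** * Harmonic functions of the walk *)

Section HarmonicFunctions.
Variables (R : realFieldType) (G1 G2 : ntFinGroupType).
Local Notation letter := (letter G1 G2).
Local Arguments normal : simpl never.
Local Notation fp := (freeprod G1 G2).
Implicit Types (u v s : letter) (w z : seq letter) (g h : fp).

Variable r : letter -> R.

Definition kap u : R := \sum_(v | ~~ same_factor u v) r v.
Definition qlet u : R := r u / kap u.
Definition qw w : R := \prod_(v <- w) qlet v.

(* Right steps on the walk are left actions on the word of the inverse, so the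
   functions below are defined by recursion on the word of [g^-1]. *)
Fixpoint wsum w : R :=
  if w is u :: w' then - 2 * r u + qlet u * (if w' is [::] then kap u else wsum w')
  else 0.

(** Here [w] is the word of [g^-1]. Compared with the full gain [size w], one letter is lost if [xi]
    starts in the factor of [u], which has probability [1 - kap u]. Each letter of [w] that then
    cancels costs two more, except that the last letter of [w] costs only one; [wsum] is the mean of
    these extra losses, counted negatively. *)
Definition wphi w : R :=
  if w is u :: _ then (size w)%:R - (1 - kap u) + wsum w else 0.

Definition phi g := wphi (nform g^-1%g).

Definition wcyl u z : R :=
  if beyond u z then 1 - (1 - kap u) * qw z else kap u * qw z.

Definition cyl u h g := wcyl u (nform (g^-1 * h)%g).

Variables (S : seq letter) (gamma theta : R).
Let N : R := (size S)%:R.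

Hypothesis r_gt0 : forall u, 0 < r u.
Hypothesis r_sum : \sum_u r u = 1.
Hypothesis q_le : forall u, qlet u <= theta.
Hypothesis theta_lt1 : theta < 1.
Hypothesis S_inv : perm_eq (map (@letter_inv G1 G2) S) S.

(** The local identities behind harmonicity: the first for [qw] at a nonempty word, the second for
    [wcyl] at the empty word, the last two for the drift of [wphi] at nonempty words and at the
    empty word. *)
Definition q_harmonic := forall u, \sum_(s <- S) qw (letter_mul s u) = N * qlet u.
Definition kap_harmonic := forall u,
  \sum_(s <- S) (if same_factor s u then kap u * qlet s else 1 - (1 - kap u) * qlet s) =
  N * kap u.
Definition drift_letter := forall u,
  \sum_(s <- S) (if same_factor s u then
                   if letter_mul s u is v :: _ then kap u - 2 * r v else - kap u
                 else 1 + kap s - 2 * r s - 2 * qlet s * r u) =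
  N * (kap u - 2 * r u + gamma).
Definition drift_one := \sum_(s <- S) (kap s - r s) = N * gamma.

Hypotheses (Hq : q_harmonic) (Hkap : kap_harmonic).
Hypotheses (Hdrift : drift_letter) (Hdrift1 : drift_one).

Lemma letter_other u : exists v, ~~ same_factor u v.
Proof.
case: u => x.
  by have [y y1] := @ntg_subproof G2; exists (inr (Sub y y1)).
by have [y y1] := @ntg_subproof G1; exists (inl (Sub y y1)).
Qed.

Lemma kap_gt0 u : 0 < kap u.
Proof.
have [v nuv] := letter_other u.
by rewrite /kap (bigD1 v) //= ltr_pwDl // sumr_ge0 // => *; exact: ltW.
Qed.

Lemma kap_diff u v : ~~ same_factor u v -> kap u = 1 - kap v.
Proof.
move=> nuv; rewrite -r_sum (bigID (fun x => same_factor v x)) /= addrK.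
by apply: eq_bigl => x; case: u v x nuv => [?|?] [?|?] [?|?].
Qed.

Lemma kap_same u v : same_factor u v -> kap u = kap v.
Proof. by move=> suv; apply: eq_bigl => x; rewrite (same_factor_trans _ suv). Qed.

Lemma kap_lt1 u : kap u < 1.
Proof.
have [v nuv] := letter_other u.
by rewrite (kap_diff nuv) ltrBlDr ltrDl kap_gt0.
Qed.

Lemma qlet_kap u : qlet u * kap u = r u.
Proof. by rewrite /qlet divfK // gt_eqF // kap_gt0. Qed.

Lemma qlet_gt0 u : 0 < qlet u.
Proof. by rewrite divr_gt0 // kap_gt0. Qed.

Lemma theta_ge0 : 0 <= theta.
Proof.
have [v _] := letter_other (proj1_sig (point : infword G1 G2) 0%N).
exact: le_trans (ltW (qlet_gt0 v)) (q_le v).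
Qed.

Lemma qw_ge0 w : 0 <= qw w.
Proof. by apply: prodr_ge0 => u _; exact/ltW/qlet_gt0. Qed.

Lemma qw_le w : qw w <= theta ^+ size w.
Proof.
elim: w => [|u w IH]; first by rewrite /qw big_nil.
rewrite /qw big_cons exprS ler_pM //; [exact/ltW/qlet_gt0|exact: qw_ge0].
Qed.

Lemma qw_le1 w : qw w <= 1.
Proof.
apply: le_trans (qw_le w) _; apply: exprn_ile1; [exact: theta_ge0|exact: ltW].
Qed.

Lemma qw_cat w z : qw (w ++ z) = qw w * qw z.
Proof. exact: big_cat. Qed.

Lemma qw_cons u w : qw (u :: w) = qlet u * qw w.
Proof. exact: big_cons. Qed.

Lemma qw_act u w : \sum_(s <- S) qw (letter_act s (u :: w)) = N * qw (u :: w).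
Proof.
rewrite qw_cons mulrA -Hq mulr_suml; apply: eq_bigr => s _.
by rewrite /= qw_cat.
Qed.

Lemma wcyl_nil u : wcyl u [::] = kap u.
Proof. by rewrite /wcyl /= /qw big_nil mulr1 opprB addrCA subrr addr0. Qed.

(* Both formulas in [wcyl] take the value [kap u] on the empty word, the only place
   where a step can switch between them. *)
Lemma wcyl_act u z : \sum_(s <- S) wcyl u (letter_act s z) = N * wcyl u z.
Proof.
case: z => [|v z].
  rewrite wcyl_nil -Hkap; apply: eq_bigr => s _.
  by rewrite /wcyl /= /qw big_seq1 same_factor_sym if_neg.
pose A b w := if b then 1 - (1 - kap u) * qw w else kap u * qw w.
have E s : wcyl u (letter_act s (v :: z)) = A (beyond u (v :: z)) (letter_act s (v :: z)).
  rewrite /wcyl -/(A _ _) /=.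
  case: z => [|x z] /=; last first.
    case: (letter_mul s v) => [|t l] //=.
    by rewrite last_cat.
  rewrite cats0; have [ssv|nsv] := boolP (same_factor s v); last first.
    by rewrite letter_mul_diff.
  have [->|[t -> svt]] := letter_mul_same ssv.
    by rewrite /A /= /qw big_nil; case: ifP => _ //; ring.
  by rewrite /= same_factor_sym -(same_factor_trans _ svt) same_factor_sym.
rewrite (eq_bigr _ (fun s _ => E s)).
rewrite /A [wcyl u (v :: z)]/wcyl; case: (beyond u _).
  rewrite sumrB -mulr_sumr qw_act big_const_seq count_predT iter_addr_0.
  by rewrite /N; ring.
by rewrite -mulr_sumr qw_act; ring.
Qed.

Lemma nformV_letter g s :
  nform (g * fp_letter s)^-1%g = letter_act (letter_inv s) (nform g^-1%g).
Proof. by rewrite invMg fp_letterV. Qed.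

Lemma cyl_harmonic u h g :
  \sum_(s <- S) cyl u h (g * fp_letter s)%g = N * cyl u h g.
Proof.
rewrite -wcyl_act -[RHS](perm_big _ S_inv) /= big_map; apply: eq_bigr => s _.
by rewrite /cyl invMg fp_letterV -mulgA nformM.
Qed.

Lemma cyl_one u h w : nform h = rcons w u -> cyl u h 1%g = qw w * r u.
Proof.
move=> hE; rewrite /cyl invg1 mul1g hE /wcyl.
have -> : beyond u (rcons w u) = false.
  by case: w {hE} => [|v w] /=; rewrite ?last_rcons same_factor_refl.
by rewrite -cats1 qw_cat /qw big_seq1 -qlet_kap; ring.
Qed.

Lemma wcyl_ge0 u z : 0 <= wcyl u z.
Proof.
rewrite /wcyl; have k0 := kap_gt0 u; have k1 := kap_lt1 u.
by have q0 := qw_ge0 z; have q1 := qw_le1 z; case: ifP => _; nra.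
Qed.

Lemma wcyl_le1 u z : wcyl u z <= 1.
Proof.
rewrite /wcyl; have k0 := kap_gt0 u; have k1 := kap_lt1 u.
by have q0 := qw_ge0 z; have q1 := qw_le1 z; case: ifP => _; nra.
Qed.

Lemma wcyl_beyond u z : `|wcyl u z - (beyond u z)%:R| <= theta ^+ size z.
Proof.
apply: le_trans (qw_le z).
rewrite /wcyl; have k0 := kap_gt0 u; have k1 := kap_lt1 u.
have q0 := qw_ge0 z; have q1 := qw_le1 z.
by rewrite ler_norml; case: ifP => _ /=; apply/andP; split; nra.
Qed.

Lemma wphi_act u w : normal (u :: w) ->
  \sum_(s <- S) wphi (letter_act s (u :: w)) = N * (wphi (u :: w) + gamma).
Proof.
(* Everything behind the first letter enters through [tau] only, linearly and with coefficient
   [qw (letter_mul s u)]: [Hq] handles this coefficient and [Hdrift] the rest. The value [kap u] at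
   the empty word makes [wE] valid there too. *)
move=> nuw; pose tau := if w is [::] then kap u else wsum w.
have wE : wphi w = (size w)%:R - kap u + tau.
  rewrite /tau; case: w nuw {tau} => [|v w]; rewrite normal_cons => nuw; first by rewrite /=; ring.
  rewrite [LHS]/wphi; have /andP[nuv _] := nuw.
  by rewrite (kap_diff nuv); ring.
have uwE : wphi (u :: w) = (size w)%:R + kap u - 2 * r u + qlet u * tau.
  by rewrite /wphi [wsum _]/= -/tau /= -[(size w).+1]addn1 natrD; ring.
have -> : N * (wphi (u :: w) + gamma) =
    N * (size w)%:R + N * (kap u - 2 * r u + gamma) + N * qlet u * tau.
  by rewrite uwE; ring.
rewrite -Hdrift -Hq mulr_suml.
have -> : N * (size w)%:R = \sum_(s <- S) (size w)%:R.
  by rewrite big_const_seq count_predT iter_addr_0 /N mulr_natl.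
rewrite -!big_split /=; apply: eq_bigr => s _.
have [ssu|nsu] := boolP (same_factor s u); last first.
  rewrite letter_mul_diff //= !qw_cons [qw [::]]big_nil -/tau.
  by rewrite -[(size w).+2]addn2 natrD; ring.
have [->|[v -> suv]] := letter_mul_same ssu.
  by rewrite /= wE [qw [::]]big_nil; ring.
have tauE : (if w is [::] then kap v else wsum w) = tau.
  by rewrite /tau (kap_same suv).
rewrite cat1s /wphi [wsum _]/= tauE qw_cons [qw [::]]big_nil (kap_same suv).
by rewrite [size _]/= -[(size w).+1]addn1 natrD; ring.
Qed.

Lemma phi_drift g :
  \sum_(s <- S) phi (g * fp_letter s)%g = N * (phi g + gamma).
Proof.
have -> : \sum_(s <- S) phi (g * fp_letter s)%g =
    \sum_(s <- S) wphi (letter_act s (nform g^-1%g)).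
  rewrite -[RHS](perm_big _ S_inv) /= big_map; apply: eq_bigr => s _.
  by rewrite /phi nformV_letter.
rewrite /phi; case: (nform _) (nformP g^-1%g) => [_|u w]; last exact: wphi_act.
rewrite add0r -Hdrift1; apply: eq_bigr => s _ /=.
by rewrite -qlet_kap; ring.
Qed.

Lemma phi_one : phi 1%g = 0.
Proof. by rewrite /phi invg1. Qed.

(** [3 / (1 - theta)] is the solution of [B = 3 + theta * B] and bounds [wsum] by recursion; the
    final 1 covers the term [1 - kap u]. *)
Definition phi_dist : R := 3 / (1 - theta) + 1.

Lemma phi_length g : `|phi g - (fp_length g)%:R| <= phi_dist.
Proof.
have t0 := theta_ge0; have t1 := theta_lt1.
have c1 : 1 <= (1 - theta)^-1 by rewrite invf_ge1 ?lerBlDr ?lerDl ?subr_gt0.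
rewrite -fp_lengthV /phi /fp_length.
have B w : `|wsum w| <= 3 / (1 - theta).
  elim: w => [|u w IH]; first by rewrite /= normr0; lra.
  have r1 : r u <= 1.
    by rewrite -qlet_kap; have := kap_gt0 u; have := kap_lt1 u;
      have := q_le u; have := qlet_gt0 u; nra.
  have : `|if w is [::] then kap u else wsum w| <= 3 / (1 - theta).
    case: w IH => // _; rewrite gtr0_norm ?kap_gt0 //.
    by have := kap_lt1 u; lra.
  rewrite /=; set tau := (if w is [::] then kap u else wsum w) => tauB.
  apply: le_trans (ler_normD _ _) _; rewrite [X in X + _]normrM [X in _ + X]normrM normrN normr_nat.
  rewrite (gtr0_norm (r_gt0 u)) (gtr0_norm (qlet_gt0 u)).
  have : qlet u * `|tau| <= theta * (3 / (1 - theta)).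
    by apply: ler_pM => //; exact/ltW/qlet_gt0.
  have : theta * (3 / (1 - theta)) = 3 / (1 - theta) - 3.
    by field; rewrite gt_eqF // subr_gt0.
  by lra.
case: (nform _) => [|u w]; first by rewrite /= subr0 normr0 /phi_dist; lra.
rewrite /wphi addrAC [X in `|X + _|]addrAC subrr add0r.
apply: le_trans (ler_normD _ _) _; rewrite addrC lerD ?B //.
by rewrite normrN ger0_norm; have := kap_gt0 u; have := kap_lt1 u; lra.
Qed.

Lemma fp_length_step g s :
  `|(fp_length (g * fp_letter s)%g)%:R - (fp_length g)%:R : R| <= 1.
Proof.
have h1 : (fp_length (g * fp_letter s)%g <= fp_length g + 1)%N.
  exact: size_word_mul.
have h2 : (fp_length g <= fp_length (g * fp_letter s)%g + 1)%N.
  have gE : g = ((g * fp_letter s) * fp_letter (letter_inv s))%g.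
    by rewrite -mulgA -fp_letterV mulgV mulg1.
  by rewrite {1}gE; exact: size_word_mul.
move: h1 h2; rewrite -!(ler_nat R) !natrD ler_norml => h1 h2.
by apply/andP; split; lra.
Qed.

Lemma phi_step g s : `|phi (g * fp_letter s)%g - phi g| <= 2 * phi_dist + 1.
Proof.
have := fp_length_step g s; have := phi_length g; have := phi_length (g * fp_letter s)%g.
rewrite !ler_norml => /andP[a1 a2] /andP[b1 b2] /andP[c1 c2].
by apply/andP; split; lra.
Qed.

End HarmonicFunctions.

(** * The harmonicity identities for the steps [a], [b], [b^-1] *)

Section CyclicFactors.
Variables (R : realType) (G1 G2 : ntFinGroupType) (k : nat) (y : R).
Variables (a : {x : G1 | x != 1%g}) (b : {x : G2 | x != 1%g}).
Variable r : letter G1 G2 -> R.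
Local Arguments normal : simpl never.
Implicit Types u : {x : G2 | x != 1%g}.

Hypothesis k3 : (3 <= k)%N.
Hypothesis y01 : 0 < y < 1 / 2.
Hypothesis yfix : Gfun k.-1 y = y.
Hypothesis a_uniq : forall x, x = a.
Hypothesis ob : #[val b]%g = k.
Hypothesis gb : [set: G2]%G = <[val b]>%g :> {set G2}.
Hypothesis ra : r (inl a) = Gfun 0 y.
Hypothesis rb : forall i u, (1 <= i <= k.-1)%N -> val u = (val b ^+ i)%g ->
  r (inr u) = Gfun i y.

Let la : letter G1 G2 := inl a.
Let lb : letter G1 G2 := inr b.
Let lb' : letter G1 G2 := letter_inv lb.
Definition steps : seq (letter G1 G2) := [:: la; lb; lb'].

Lemma Gfun0_k : Gfun k y = Gfun 0 y.
Proof. by rewrite -(Gfun_sym k3 y01 yfix (leq0n k)) subn0. Qed.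

Lemma gen_letter u : exists2 i, (0 < i < k)%N & val u = (val b ^+ i)%g.
Proof.
have /cyclePmin[i ik uE] : val u \in <[val b]>%g by rewrite -gb inE.
exists i => //; rewrite lt0n -ob ik andbT; apply: contra (valP u) => /eqP i0.
by rewrite uE i0 expg0.
Qed.

Lemma r_letter i u : (0 < i < k)%N -> val u = (val b ^+ i)%g -> r (inr u) = Gfun i y.
Proof. by case: k k3 rb => // k' _ h /andP[i0 ik]; apply: h; rewrite i0. Qed.

Lemma a_inv : letter_inv la = la.
Proof. by rewrite /= [X in inl X]a_uniq. Qed.

Lemma a_sq : letter_mul la la = [::].
Proof. by rewrite -{1}a_inv letter_mulV. Qed.

Lemma steps_inv : perm_eq (map (@letter_inv G1 G2) steps) steps.
Proof.
rewrite (_ : map _ _ = [:: letter_inv la; letter_inv lb; letter_inv lb']) //.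
by rewrite a_inv letter_invK perm_cons (perm_catC [:: _] [:: _]).
Qed.

Lemma val_lb' : exists2 u, lb' = inr u & val u = (val b ^+ k.-1)%g.
Proof.
exists (Sub (val b)^-1%g (letter_inv_subproof b)) => //=.
by rewrite invg_expg ob.
Qed.

Lemma r_lb : r lb = y.
Proof. by rewrite (r_letter (i := 1)) ?expg1 //; apply: leq_trans k3. Qed.

Lemma r_lb' : r lb' = y.
Proof.
have [u -> uE] := val_lb'; rewrite (r_letter (i := k.-1) _ uE) //.
by case: k k3 => [|[|k']] //= _.
Qed.

(** When the product is trivial, [j] is 0 or [k], and there [Gfun] equals [Gfun 0 y]. So
    [Gfun j y / Gfun 0 y] is the [qw] of the product in both cases. *)
Lemma mul_letter s u j : (j <= k)%N -> (val s * val u = val b ^+ j)%g ->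
  (letter_mul (inr s : letter G1 G2) (inr u) = [::] /\ Gfun j y = Gfun 0 y) \/
  (exists2 v : {x : G2 | x != 1%g},
     letter_mul (inr s : letter G1 G2) (inr u) = [:: inr v] & r (inr v) = Gfun j y).
Proof.
move=> jk suE; rewrite /=; case: insubP => [v v1 vE|/negPn/eqP su1]; [right|left].
  exists v => //; apply: r_letter; last by rewrite vE.
  move: v1; rewrite suE => v1; rewrite lt0n ltn_neqAle jk andbT.
  apply/andP; split; apply: contra v1 => /eqP ->; first by rewrite expg0.
  by rewrite -ob expg_order.
split=> //; move/eqP: su1; rewrite suE -order_dvdn ob => kj.
case: j kj jk {suE} => // j kj jk.
have -> : j.+1 = k by apply/eqP; rewrite eqn_leq jk dvdn_leq.
exact: Gfun0_k.
Qed.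

Lemma mul_lb i u : (0 < i < k)%N -> val u = (val b ^+ i)%g ->
  (letter_mul lb (inr u) = [::] /\ Gfun i.+1 y = Gfun 0 y) \/
  (exists2 v : {x : G2 | x != 1%g}, letter_mul lb (inr u) = [:: inr v] & r (inr v) = Gfun i.+1 y).
Proof. by move=> /andP[_ ik] uE; apply: mul_letter => //; rewrite uE -expgS. Qed.

Lemma mul_lb' i u : (0 < i < k)%N -> val u = (val b ^+ i)%g ->
  (letter_mul lb' (inr u) = [::] /\ Gfun i.-1 y = Gfun 0 y) \/
  (exists2 v : {x : G2 | x != 1%g}, letter_mul lb' (inr u) = [:: inr v] & r (inr v) = Gfun i.-1 y).
Proof.
move=> /andP[i0 ik] uE; apply: mul_letter.
  by rewrite (leq_trans (leq_pred _)) // ltnW.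
by rewrite /= uE -(prednK i0) expgS mulgA mulVg mul1g.
Qed.

Lemma sum_letters : \sum_(u : letter G1 G2) r u = 1 /\ \sum_u r (inr u) = 1 - Gfun 0 y.
Proof.
have sumb : \sum_u r (inr u) = 1 - Gfun 0 y.
  rewrite -(Gfun_sum k3 y01 yfix) addrAC subrr add0r big_add1 big_mkord.
  have ik (i : 'I_k.-1) : (i.+1 < k)%N.
    by rewrite -[X in (_ < X)%N](ltn_predK k3) ltnS.
  have ne (i : 'I_k.-1) : (val b ^+ i.+1)%g != 1%g.
    by rewrite -order_dvdn ob gtnNdvd.
  pose f i : {x : G2 | x != 1%g} :=
    exist (fun x : G2 => x != 1%g) _ (ne i).
  have fi : injective f.
    move=> i j /(congr1 val)/eqP; rewrite /= eq_expg_mod_order ob !modn_small //.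
    by rewrite eqSS => /eqP/val_inj.
  have fb : bijective f.
    apply: inj_card_bij => //; rewrite card_ord card_sig.
    have -> : #|[pred x : G2 | x != 1%g]| = #|[set: G2]%G|.-1.
      by rewrite cardsT -(cardsC1 1%g); apply: eq_card => x; rewrite !inE.
    by rewrite gb -orderE ob.
  rewrite (reindex f) /=; last exact: onW_bij.
  by apply: eq_bigr => i _; rewrite (@r_letter i.+1 (f i)) //= ik.
split=> //; rewrite big_sumType /= sumb (bigD1 a) //= big1; last first.
  by move=> i; rewrite (a_uniq i) eqxx.
by rewrite ra addr0 addrC subrK.
Qed.

Lemma r_pos (u : letter G1 G2) : 0 < r u.
Proof.
have /andP[y0 y1] := y01.
case: u => x; first by rewrite (a_uniq x) ra /=; lra.
have [i ik xE] := gen_letter x; rewrite (r_letter ik xE).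
by have /andP[] := Gfun_bound k3 y01 yfix ik.
Qed.

Lemma kap_inl x : kap r (inl x) = 1 - Gfun 0 y.
Proof.
by rewrite /kap big_mkcond big_sumType /= big1 // add0r; case: sum_letters.
Qed.

Lemma kap_inr x : kap r (inr x) = Gfun 0 y.
Proof.
rewrite /kap big_mkcond big_sumType /= [X in _ + X]big1 // addr0.
rewrite (bigD1 a) //= big1 ?addr0 //.
by move=> i; rewrite (a_uniq i) eqxx.
Qed.

Lemma q_la : qlet r la = (1 + 2 * y) / (3 - 2 * y).
Proof.
rewrite /qlet kap_inl ra /=; have /andP[y0 y1] := y01.
by field; rewrite !gt_eqF //; lra.
Qed.

Lemma q_inr x : qlet r (inr x) = r (inr x) / Gfun 0 y.
Proof. by rewrite /qlet kap_inr. Qed.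

Lemma q_lb : qlet r lb = y / Gfun 0 y.
Proof. by rewrite q_inr r_lb. Qed.

Lemma q_lb' : qlet r lb' = y / Gfun 0 y.
Proof. by have [u E _] := val_lb'; rewrite E q_inr -E r_lb'. Qed.

Lemma q_bound : exists2 theta, theta < 1 & forall u : letter G1 G2, qlet r u <= theta.
Proof.
exists (\big[Num.max/0]_u qlet r u); last by move=> u; exact: le_bigmax.
apply: bigmax_lt => // u _; have /andP[y0 y1] := y01.
case: u => x; first by rewrite (a_uniq x) q_la ltr_pdivrMr; lra.
have [i ik xE] := gen_letter x; rewrite q_inr (r_letter ik xE).
have /andP[h0 h1] := Gfun_bound k3 y01 yfix ik.
by rewrite ltr_pdivrMr ?mul1r //; exact: lt_trans h1.
Qed.

(** The coefficient [8 * (1 - y) / (3 - 2 * y)] is 3 minus the value of [qlet] at [a], so the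
    recurrence is the averaging identity at a power of [b]. *)
Lemma Gfun_harm i : (0 < i < k)%N ->
  (1 + 2 * y) / (3 - 2 * y) * Gfun i y + Gfun i.+1 y + Gfun i.-1 y = 3 * Gfun i y.
Proof.
move=> /andP[]; case: i => // i _ _; have /andP[y0 y1] := y01.
by rewrite [Gfun i.+2 y]/= -/(Gfun i.+1 y) /=; field; rewrite gt_eqF //; lra.
Qed.

Lemma sum_steps (f : letter G1 G2 -> R) : \sum_(s <- steps) f s = f la + f lb + f lb'.
Proof. by rewrite /steps !big_cons big_nil addr0 addrA. Qed.

(** At [a] the identity reads [1 + 2 q(a) q(b) = 3 q(a)], which determines the affine form of
    [Gfun 0]; at a power of [b] it is [Gfun_harm] divided by [Gfun 0 y]. *)
Lemma steps_q : q_harmonic r steps.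
Proof.
have /andP[y0 y1] := y01.
move=> u; case: u => x; rewrite sum_steps [size steps]/=.
  rewrite (a_uniq x) -/la a_sq letter_mul_diff // letter_mul_diff //.
  rewrite !qw_cons ![qw _ [::]]big_nil q_la q_lb q_lb' /=.
  by field; rewrite !gt_eqF //; lra.
have [i ik xE] := gen_letter x.
have A0 : Gfun 0 y != 0 :> R by rewrite gt_eqF //= ; lra.
have Q s j : (letter_mul s (inr x) = [::] /\ Gfun j y = Gfun 0 y) \/
  (exists2 v : {x : G2 | x != 1%g}, letter_mul s (inr x) = [:: inr v] & r (inr v) = Gfun j y) ->
  qw r (letter_mul s (inr x)) = Gfun j y / Gfun 0 y.
  case=> [[-> ->]|[v -> rv]]; first by rewrite [LHS]big_nil divff.
  by rewrite qw_cons [qw _ [::]]big_nil mulr1 q_inr rv.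
rewrite (Q _ _ (mul_lb ik xE)) (Q _ _ (mul_lb' ik xE)).
rewrite letter_mul_diff // !qw_cons [qw _ [::]]big_nil mulr1 q_la q_inr (r_letter ik xE).
rewrite [RHS]mulrA -(Gfun_harm ik); ring.
Qed.

Lemma steps_kap : kap_harmonic r steps.
Proof.
have /andP[y0 y1] := y01.
move=> u; case: u => x; rewrite sum_steps [size steps]/= ?kap_inl ?kap_inr /= -/lb' q_lb q_lb' q_la /=;
  by field; rewrite !gt_eqF //; lra.
Qed.

Lemma steps_drift : drift_letter r steps ((1 - 2 * y) / 3).
Proof.
have /andP[y0 y1] := y01.
move=> u; case: u => x; rewrite sum_steps [size steps]/=.
  rewrite (a_uniq x) -/la a_sq /= -/lb' !kap_inl !kap_inr r_lb r_lb' q_lb q_lb' ra /=.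
  by field; rewrite !gt_eqF //; lra.
have [i ik xE] := gen_letter x.
have Q s j : (letter_mul s (inr x) = [::] /\ Gfun j y = Gfun 0 y) \/
  (exists2 v : {x : G2 | x != 1%g}, letter_mul s (inr x) = [:: inr v] & r (inr v) = Gfun j y) ->
  (if letter_mul s (inr x) is v :: _ then kap r (inr x) - 2 * r v else - kap r (inr x)) =
  Gfun 0 y - 2 * Gfun j y.
  case=> [[-> ->]|[v -> rv]]; rewrite kap_inr; first by ring.
  by rewrite rv.
rewrite [same_factor la _]/= [same_factor lb _]/= [same_factor lb' _]/=.
rewrite (Q _ _ (mul_lb ik xE)) (Q _ _ (mul_lb' ik xE)).
rewrite kap_inl kap_inr q_la ra (r_letter ik xE).
have := Gfun_harm ik; move: (Gfun i.+1 y) (Gfun i.-1 y) (Gfun i y) => p m c.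
by rewrite [Gfun 0 y]/=; move: ((1 + 2 * y) / (3 - 2 * y)) => q h; lra.
Qed.

Lemma steps_drift1 : drift_one r steps ((1 - 2 * y) / 3).
Proof.
rewrite /drift_one sum_steps [size steps]/= kap_inl kap_inr.
have [u E _] := val_lb'; rewrite {1}E kap_inr ra r_lb r_lb' /=; lra.
Qed.

End CyclicFactors.

(** * Law of the walk *)

HB.instance Definition _ (G1 G2 : ntFinGroupType) :=
  [Countable of freeprod G1 G2 by <:].

Section RandomWalkLaw.
Variables (R : realType) (G1 G2 : ntFinGroupType).
Local Notation fp := (freeprod G1 G2).
Variables (S : seq (letter G1 G2)) (mu : probability fp R).
Let N : R := (size S)%:R.
Hypothesis S_uniq : uniq S.
Hypothesis S_gt0 : (0 < size S)%N.
Hypothesis muS : forall s, s \in S -> mu [set fp_letter s] = (N^-1)%:E.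
Variables (d : measure_display) (T : measurableType d) (P : probability T R).
Variable x : nat -> {RV P >-> fp}.
Hypothesis x_iid : iid_of_law mu x.
Implicit Types (l : seq (letter G1 G2)) (s : letter G1 G2) (g : fp).

Lemma measurable_step n (B : set fp) : measurable (x n @^-1` B).
Proof. by rewrite -[X in measurable X]setTI; exact: measurable_funP. Qed.

Lemma measurable_walk n (B : set fp) : measurable (walk x n @^-1` B).
Proof.
elim: n B => [|n IH] B.
  have [B1|B1] := pselect (B 1%g).
    by rewrite (_ : _ @^-1` _ = setT) //; apply/seteqP; split.
  by rewrite (_ : _ @^-1` _ = set0) //; apply/seteqP; split.
rewrite (_ : _ @^-1` _ = \bigcup_g (walk x n @^-1` [set g] `&`
    x n @^-1` [set h | B (g * h)%g])).
  apply: countable_bigcupT_measurable => [|g]; first exact: countableP.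
  by apply: measurableI; [exact: IH|exact: measurable_step].
apply/seteqP; split => [t Bt|t [g _ [/= <-]]] //.
by exists (walk x n t).
Qed.

Lemma measurable_fun_walk n (F : fp -> R) :
  measurable_fun [set: T] (EFin \o F \o walk x n).
Proof.
by move=> _ Y _; rewrite setTI; exact: (measurable_walk n [set g | Y (F g)%:E]).
Qed.

Definition support : set fp := \bigcup_(s in [set` S]) [set fp_letter s].

Lemma fp_letter_inj : injective (@fp_letter G1 G2).
Proof. by move=> u v /(congr1 (@nform _ _)) []. Qed.

Lemma N_neq0 : N != 0.
Proof. by rewrite pnatr_eq0 -lt0n. Qed.

Lemma mu_support : mu support = 1%E.
Proof.
rewrite measure_fin_bigcup //; last first.
  apply/trivIsetP => s s' _ _ ss'; apply/seteqP; split => // g.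
  by move=> [/= -> /fp_letter_inj/eqP]; rewrite (negbTE ss').
rewrite -fsbig_seq // (eq_big_seq (fun=> (N^-1)%:E)) => [|s /muS //].
rewrite sumEFin big_const_seq count_predT iter_addr_0.
by rewrite -mulr_natl mulfV // N_neq0.
Qed.

Lemma law_step n (B : set fp) : P (x n @^-1` B) = mu B.
Proof. exact: x_iid.2. Qed.

Lemma step_support n : P (x n @^-1` ~` support) = 0%E.
Proof. by rewrite law_step probability_setC // mu_support subee. Qed.

Lemma ae_step_support : {ae P, forall t n, exists2 s, s \in S & x n t = fp_letter s}.
Proof.
apply: ae_foralln => n; exists (x n @^-1` ~` support); split.
- exact: measurable_step.
- exact: step_support.
- by move=> t /= H [s sS xE]; apply: H; exists s.
Qed.

Definition path_event l : set T :=
  [set t | forall j, (j < size l)%N -> x j t = nth 1%g (map (@fp_letter _ _) l) j].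

Lemma path_event_rcons l s :
  path_event (rcons l s) = path_event l `&` x (size l) @^-1` [set fp_letter s].
Proof.
rewrite /path_event map_rcons size_rcons; apply/seteqP; split => t /=.
  move=> H; split=> [j jl|]; last first.
    by rewrite H // nth_rcons size_map ltnn eqxx.
  by rewrite H ?nth_rcons ?size_map ?jl // ltnS ltnW.
move=> [H H'] j; rewrite ltnS leq_eqVlt nth_rcons size_map.
by move=> /predU1P[->|jl]; [rewrite ltnn eqxx|rewrite jl; exact: H].
Qed.

Lemma measurable_path_event l : measurable (path_event l).
Proof.
elim/last_ind: l => [|l s IH].
  by rewrite (_ : path_event _ = setT) //; apply/seteqP; split.
by rewrite path_event_rcons; apply: measurableI => //; exact: measurable_step.
Qed.

Lemma prob_path_event l : {subset l <= S} -> P (path_event l) = (N^-1 ^+ size l)%:E.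
Proof.
move=> lS; rewrite (_ : path_event l = \bigcap_(j in [set` iota 0 (size l)])
    x j @^-1` [set nth 1%g (map (@fp_letter _ _) l) j]); last first.
  by apply/seteqP; split => t H j; move: (H j); rewrite /= mem_iota.
rewrite x_iid.1 //; last exact: iota_uniq.
rewrite (eq_big_seq (fun=> (N^-1)%:E)) => [|j].
  rewrite prodEFin; congr EFin.
  by rewrite big_const_seq count_predT size_iota iter_mulr_1.
rewrite mem_iota /= add0n => jl.
have s0 : letter G1 G2 by case: l jl {lS} => // s.
by rewrite (nth_map s0) // law_step muS // lS // mem_nth.
Qed.

Lemma walk_path_event l t : path_event l t ->
  walk x (size l) t = (\prod_(s <- l) fp_letter s)%g.
Proof.
elim/last_ind: l => [|l s IH]; first by rewrite big_nil.
rewrite path_event_rcons => -[/IH lt /= xs].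
by rewrite size_rcons big_rcons /= lt xs.
Qed.

Lemma integral_path_event l (f : T -> \bar R) : measurable_fun setT f ->
  (forall t, 0 <= f t)%E ->
  (\int[P]_(t in path_event l) f t =
   \sum_(s <- S) \int[P]_(t in path_event (rcons l s)) f t)%E.
Proof.
move=> mf f0.
rewrite (ge0_negligible_integral (N := x (size l) @^-1` ~` support)) //; last 4 first.
- exact: measurable_step.
- exact: measurable_path_event.
- exact: measurable_funS mf.
- exact: step_support.
rewrite (_ : _ `\` _ = \big[setU/set0]_(s <- S) path_event (rcons l s)); last first.
  rewrite -bigcup_seq; apply/seteqP; split => t.
    move=> [lt /= /contrapT[s sS /= xs]]; exists s => //.
    by rewrite path_event_rcons.
  move=> [s sS]; rewrite path_event_rcons => -[lt /= xs]; split=> //=.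
  by apply; exists s.
apply: ge0_integral_bigsetU => //.
- by move=> s; exact: measurable_path_event.
- apply/trivIsetP => s s' _ _ ss'; rewrite !path_event_rcons.
  apply/seteqP; split => // t [[_ /= ->] [_ /= /fp_letter_inj/eqP]].
  by rewrite (negbTE ss').
- exact: measurable_funS mf.
Qed.

Fixpoint avg m (F : fp -> R) g : R :=
  if m is m'.+1 then N^-1 * \sum_(s <- S) avg m' F (g * fp_letter s)%g else F g.

(** Induction on the number [m] of remaining steps: the event of having followed [l] splits, up to a
    null set, into its one-letter extensions, and for [m = 0] the position is constant on it. *)
Lemma integral_walk_path (F : fp -> R) l m : (forall g, 0 <= F g) -> {subset l <= S} ->
  (\int[P]_(t in path_event l) (F (walk x (size l + m) t))%:E =
   (N^-1 ^+ size l * avg m F (\prod_(s <- l) fp_letter s)%g)%:E)%E.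
Proof.
move=> F0; elim: m l => [|m IH] l lS.
  rewrite addn0 (eq_integral (fun=> (F (\prod_(s <- l) fp_letter s)%g)%:E)); last first.
    by move=> t; rewrite inE => /walk_path_event ->.
  rewrite integral_cst; last exact: measurable_path_event.
  by rewrite mulrC EFinM; congr (_ * _)%E; exact: prob_path_event.
rewrite integral_path_event; last 2 first.
- exact: measurable_fun_walk.
- by move=> t; rewrite lee_fin.
rewrite (eq_big_seq (fun s =>
    (N^-1 ^+ (size l).+1 * avg m F ((\prod_(s <- l) fp_letter s) * fp_letter s)%g)%:E)).
  by rewrite sumEFin -mulr_sumr exprSr -mulrA.
move=> s sS; have := IH (rcons l s); rewrite size_rcons addSnnS big_rcons; apply.
by move=> u; rewrite mem_rcons in_cons => /predU1P[->//|/lS].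
Qed.

Lemma integral_walk (F : fp -> R) m : (forall g, 0 <= F g) ->
  (\int[P]_t (F (walk x m t))%:E = (avg m F 1%g)%:E)%E.
Proof.
move=> F0; have := @integral_walk_path F [::] m F0 (fun _ => ltac:(by [])).
rewrite expr0 mul1r big_nil => <-.
by congr integral; apply/seteqP; split.
Qed.

Lemma avg_harmonic (F : fp -> R) m g :
  (forall h, \sum_(s <- S) F (h * fp_letter s)%g = N * F h) -> avg m F g = F g.
Proof.
move=> H; elim: m g => //= m IH g.
by under eq_bigr do rewrite IH; rewrite H mulKf // N_neq0.
Qed.

End RandomWalkLaw.

(** * A strong law from fourth moments *)

Section StrongLaw.
Variables (R : realType) (G1 G2 : ntFinGroupType).
Local Notation fp := (freeprod G1 G2).
Variables (S : seq (letter G1 G2)) (mu : probability fp R).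
Let N : R := (size S)%:R.
Hypothesis S_uniq : uniq S.
Hypothesis S_gt0 : (0 < size S)%N.
Hypothesis muS : forall s, s \in S -> mu [set fp_letter s] = (N^-1)%:E.
Variables (d : measure_display) (T : measurableType d) (P : probability T R).
Variable x : nat -> {RV P >-> fp}.
Hypothesis x_iid : iid_of_law mu x.
Variables (phi : fp -> R) (gamma C : R).
Hypothesis phi1 : phi 1%g = 0.
Hypothesis phi_drift : forall g,
  \sum_(s <- S) phi (g * fp_letter s)%g = N * (phi g + gamma).
Hypothesis phi_step : forall g s, `|phi (g * fp_letter s)%g - phi g - gamma| <= C.

(** [D] is a centred increment: the last summand is linear in [D] and averages to zero. The
    coefficients [8 * C ^+ 2] and [4 * C ^+ 4] leave a difference that is a sum of nonnegative
    terms. *)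
Lemma fourth_moment_step (j : nat) (m D : R) : `|D| <= C ->
  (m + D) ^+ 4 + 8 * C ^+ 2 * j%:R * (m + D) ^+ 2 + 4 * C ^+ 4 * j%:R ^+ 2 <=
  m ^+ 4 + 8 * C ^+ 2 * j.+1%:R * m ^+ 2 + 4 * C ^+ 4 * j.+1%:R ^+ 2 +
  D * (4 * m ^+ 3 + 16 * C ^+ 2 * j%:R * m).
Proof.
move=> DC; have C0 : 0 <= C by exact: le_trans DC.
have j0 : 0 <= j%:R :> R by [].
have E : D ^+ 2 <= C ^+ 2 by rewrite -[D ^+ 2]real_normK ?num_real // lerXn2r ?nnegrE.
have D0 : 0 <= D ^+ 2 by exact: sqr_ge0.
have h1 : 0 <= (C ^+ 2 - D ^+ 2) * m ^+ 2 by rewrite mulr_ge0 ?sqr_ge0 ?subr_ge0.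
have h2 : 0 <= D ^+ 2 * (m - D) ^+ 2 by rewrite mulr_ge0 ?sqr_ge0.
have h3 : 0 <= (C ^+ 2 - D ^+ 2) * (C ^+ 2 + D ^+ 2).
  by rewrite mulr_ge0 ?subr_ge0 // addr_ge0 ?sqr_ge0.
have h4 : 0 <= C ^+ 2 * (C ^+ 2 - D ^+ 2) * j%:R.
  by rewrite !mulr_ge0 ?sqr_ge0 ?subr_ge0.
have h5 : 0 <= C ^+ 2 * C ^+ 2 by rewrite mulr_ge0 ?sqr_ge0.
rewrite -[j.+1]addn1 natrD -subr_ge0.
rewrite [X in 0 <= X](_ : _ = 8 * ((C ^+ 2 - D ^+ 2) * m ^+ 2) +
  2 * (D ^+ 2 * (m - D) ^+ 2) + 3 * ((C ^+ 2 - D ^+ 2) * (C ^+ 2 + D ^+ 2)) +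
  8 * (C ^+ 2 * (C ^+ 2 - D ^+ 2) * j%:R) + C ^+ 2 * C ^+ 2); last by ring.
by rewrite !addr_ge0 // mulr_ge0.
Qed.

(* The right-hand side is propagated backwards along the walk, so that no
   conditional expectation is needed. *)
Lemma fourth_moment (j : nat) c g :
  avg S j (fun h => (phi h - c - j%:R * gamma) ^+ 4) g <=
  (phi g - c) ^+ 4 + 8 * C ^+ 2 * j%:R * (phi g - c) ^+ 2 + 4 * C ^+ 4 * j%:R ^+ 2.
Proof.
elim: j c g => [|j IH] c g.
  by rewrite /= !(mulr0, mul0r, expr0n, subr0, addr0).
have N0 : 0 < N by rewrite ltr0n.
rewrite /= ler_pdivrMl //; pose m := phi g - c.
apply: (@le_trans _ _ (\sum_(s <- S) (m ^+ 4 + 8 * C ^+ 2 * j.+1%:R * m ^+ 2 +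
    4 * C ^+ 4 * j.+1%:R ^+ 2 + (phi (g * fp_letter s)%g - phi g - gamma) *
    (4 * m ^+ 3 + 16 * C ^+ 2 * j%:R * m)))).
  apply: ler_sum => s _; apply: le_trans (fourth_moment_step j m (phi_step g s)).
  have -> : (fun h => (phi h - c - j.+1%:R * gamma) ^+ 4) =
            (fun h => (phi h - (c + gamma) - j%:R * gamma) ^+ 4).
    by apply/funext => h; rewrite -[j.+1]addn1 natrD; congr (_ ^+ 4); ring.
  apply: le_trans (IH _ _) _.
  have -> : phi (g * fp_letter s)%g - (c + gamma) =
            m + (phi (g * fp_letter s)%g - phi g - gamma) by rewrite /m; ring.
  exact: lexx.
have sc (a : R) : \sum_(s <- S) a = N * a.
  by rewrite big_const_seq count_predT iter_addr_0 /N mulr_natl.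
rewrite big_split -mulr_suml /= !sumrB phi_drift !sc.
by rewrite le_eqVlt; apply/orP; left; apply/eqP; rewrite /m; ring.
Qed.

(** Comparison with the telescoping series of [u^-1 - (u + 1)^-1]. *)
Lemma sum_inv_sq n : \sum_(0 <= i < n) (i.+1%:R ^- 2 : R) <= 2.
Proof.
case: n => [|n]; first by rewrite big_geq.
apply: (@le_trans _ _ (2 - n.+1%:R^-1)); last by rewrite lerBlDr lerDl invr_ge0.
elim: n => [|n IH]; first by rewrite big_nat1 expr1n invr1; lra.
rewrite big_nat_recr //=; apply: le_trans (lerD IH (lexx _)) _.
rewrite -[n.+2]addn1 natrD; have : 1 <= n.+1%:R :> R by rewrite ler1n.
move: (n.+1%:R) => u u1.
suff : (u + 1) ^- 2 <= u^-1 - (u + 1)^-1.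
  by move: (_ ^- 2) (u^-1) ((u + 1)^-1) => a b c; lra.
have -> : u^-1 - (u + 1)^-1 = (u * (u + 1))^-1.
  by field; rewrite !gt_eqF //; lra.
by rewrite lef_pV2 ?posrE; nra.
Qed.

(** The fourth moment of [phi / n - gamma] at time [n] is of order [n ^- 2]. The sum over [n] of
    these fourth powers is thus integrable, hence almost surely finite, and its terms tend to 0. *)
Lemma phi_strong_law :
  {ae P, forall t, phi (walk x n t) / n%:R @[n --> \oo] --> gamma}.
Proof.
pose F n g := ((phi g - n.+1%:R * gamma) / n.+1%:R) ^+ 4.
have F0 n g : 0 <= F n g by rewrite exprn_even_ge0.
pose f n : T -> \bar R := EFin \o F n \o walk x n.+1.
have mf n : measurable_fun setT (f n) by exact: measurable_fun_walk.
have f0 n t : (0 <= f n t)%E by rewrite lee_fin.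
have If n : (\int[P]_t f n t <= (4 * C ^+ 4)%:E * (n.+1%:R ^- 2)%:E)%E.
  rewrite (integral_walk S_uniq S_gt0 muS x_iid n.+1 (F0 n)) -EFinM lee_fin.
  have avgZ m (H : fp -> R) c g : avg S m (fun h => H h * c) g = avg S m H g * c.
    elim: m g => //= m IH g; rewrite -mulrA mulr_suml.
    by congr (_ * _); apply: eq_bigr => s _; rewrite IH.
  have -> : F n = (fun h => (phi h - 0 - n.+1%:R * gamma) ^+ 4 * n.+1%:R ^- 4).
    by apply/funext => h; rewrite /F subr0 exprMn exprVn.
  rewrite avgZ ler_pdivrMr ?exprn_gt0 //.
  apply: le_trans (fourth_moment n.+1 0 1%g) _.
  rewrite phi1 subr0 !expr0n !mulr0 add0r add0r.
  have : n.+1%:R != 0 :> R by [].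
  move: (n.+1%:R) => u u0; rewrite le_eqVlt; apply/orP; left; apply/eqP.
  by field.
pose g t := (\sum_(n <oo) f n t)%E.
have mg : measurable_fun setT g by exact: ge0_emeasurable_sum.
have g0 t : (0 <= g t)%E by exact: nneseries_ge0.
have Ig : (\int[P]_t g t < +oo)%E.
  rewrite integral_nneseries //.
  apply: (@le_lt_trans _ _ ((4 * C ^+ 4 * 2)%:E)); last exact: ltry.
  apply: lime_le.
    by apply: is_cvg_nneseries => n _ _; exact: integral_ge0.
  apply: nearW => n.
  apply: (@le_trans _ _ (\sum_(0 <= i < n) ((4 * C ^+ 4)%:E * (i.+1%:R ^- 2)%:E))%E).
    by apply: lee_sum => i _; exact: If.
  under eq_bigr do rewrite -EFinM.
  rewrite sumEFin lee_fin -mulr_sumr; apply: ler_wpM2l; last exact: sum_inv_sq.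
  by rewrite mulr_ge0 // exprn_even_ge0.
have ig : P.-integrable setT g.
  by apply/integrableP; split=> //; under eq_integral do rewrite gee0_abs //.
have := integrable_ae measurableT ig; apply: filterS => t /(_ I) gfin.
have goo : (\sum_(0 <= n <oo) f n t < +oo)%E.
  by move: gfin; rewrite ge0_fin_numE.
(* Each term is at most the tail of the convergent series starting at it. *)
have tail := nneseries_tail_cvg goo (fun k _ => f0 k t).
have f_0 : (f n t @[n --> \oo] --> 0)%E.
  apply: (squeeze_cvge _ (cvg_cst 0%E) tail); apply: nearW => n.
  rewrite f0 /=; apply: le_trans (nneseries_lim_ge n.+1 _); last by move=> *; exact: f0.
  by rewrite big_nat1.
have F_0 : F n (walk x n.+1 t) @[n --> \oo] --> (0 : R) by exact: (fine_cvg f_0).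
rewrite -(cvg_shiftS (fun n => phi (walk x n t) / n%:R)).
apply/cvgrPdist_lt => e e0.
move/cvgrPdist_lt : F_0 => /(_ (e ^+ 4)); rewrite exprn_gt0 // => /(_ isT).
apply: filterS => n; rewrite sub0r normrN ger0_norm // /F => h.
have -> : gamma - phi (walk x n.+1 t) / n.+1%:R =
    - ((phi (walk x n.+1 t) - n.+1%:R * gamma) / n.+1%:R).
  by rewrite mulrBl mulrAC mulfV ?mul1r ?opprB // pnatr_eq0.
rewrite normrN -(ltr_pXn2r (isT : (0 < 4)%N)) ?nnegrE ?normr_ge0 ?(ltW e0) //.
by rewrite -normrX ger0_norm // exprn_even_ge0.
Qed.

End StrongLaw.

(** * The limit word *)

Section LimitWord.
Variables (R : realType) (G1 G2 : ntFinGroupType).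
Local Notation fp := (freeprod G1 G2).
Local Notation iw := (infword G1 G2).
Local Arguments normal : simpl never.
Variables (r : letter G1 G2 -> R) (S : seq (letter G1 G2)) (gamma theta : R).
Let N : R := (size S)%:R.
Hypothesis S_uniq : uniq S.
Hypothesis S_gt0 : (0 < size S)%N.
Hypothesis r_gt0 : forall u, 0 < r u.
Hypothesis r_sum : \sum_u r u = 1.
Hypothesis q_le : forall u, qlet r u <= theta.
Hypothesis theta_lt1 : theta < 1.
Hypothesis S_inv : perm_eq (map (@letter_inv G1 G2) S) S.
Hypothesis Hq : q_harmonic r S.
Hypothesis Hkap : kap_harmonic r S.
Hypothesis Hdrift : drift_letter r S gamma.
Hypothesis Hdrift1 : drift_one r S gamma.
Hypothesis gamma_gt0 : 0 < gamma.
Variable mu : probability fp R.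
Hypothesis muS : forall s, s \in S -> mu [set fp_letter s] = (N^-1)%:E.
Variables (d : measure_display) (T : measurableType d) (P : probability T R).
Variable x : nat -> {RV P >-> fp}.
Hypothesis x_iid : iid_of_law mu x.

Lemma walk_drift : is_drift x gamma.
Proof.
have phi_stepg g s : `|phi r (g * fp_letter s)%g - phi r g - gamma| <=
    2 * phi_dist theta + 1 + `|gamma|.
  apply: le_trans (ler_normB _ _) _; rewrite lerD2r.
  exact: (phi_step r_gt0 r_sum q_le theta_lt1).
have := phi_strong_law S_uniq S_gt0 muS x_iid (phi_one r)
  (phi_drift r_gt0 r_sum S_inv Hq Hdrift Hdrift1) phi_stepg.
apply: filterS => t phiL.
pose e n := ((fp_length (walk x n t))%:R - phi r (walk x n t)) / n%:R.
suff e0 : e n @[n --> \oo] --> 0.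
  have -> : (fun n => (fp_length (walk x n t))%:R / n%:R : R) =
            (fun n => phi r (walk x n t) / n%:R + e n).
    by apply/funext => n; rewrite /e -mulrDl addrC subrK.
  by rewrite -[gamma]addr0; exact: cvgD.
rewrite -cvg_shiftS.
have h0 : phi_dist theta * (harmonic n : R) @[n --> \oo] --> 0.
  by rewrite -(mulr0 (phi_dist theta)); apply: cvgMr; exact: cvg_harmonic.
apply: norm_cvg0; apply: (squeeze_cvgr _ (cvg_cst 0) h0); apply: nearW => n.
rewrite normr_ge0 /e normrM normrV ?unitfE ?pnatr_eq0 // normr_nat ler_pM2r ?invr_gt0 //.
by rewrite distrC (phi_length r_gt0 r_sum q_le theta_lt1).
Qed.

(** Eventually the length exceeds [n * (gamma / 2)], and this exceeds [m] as soon as [n] is larger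
    than [K]. *)
Lemma drift_length (g : nat -> fp) :
  (fp_length (g n))%:R / n%:R @[n --> \oo] --> gamma ->
  forall m, \forall n \near \oo, (m <= fp_length (g n))%N.
Proof.
move=> gl m.
have g2 : 0 < gamma / 2 by rewrite divr_gt0.
move/cvgrPdist_lt : gl => /(_ _ g2) H.
pose K := Num.truncn (m%:R / (gamma / 2)).
near=> n.
have n0 : (0 < n)%N by near: n; exists 1%N.
have nK : (K < n)%N by near: n; exists K.+1.
have : `|gamma - (fp_length (g n))%:R / n%:R| < gamma / 2 by near: n.
rewrite ltr_norml => /andP[_].
have nn : 0 < n%:R :> R by rewrite ltr0n.
move=> h; rewrite -(ler_nat R).
have : gamma / 2 < (fp_length (g n))%:R / n%:R by lra.
rewrite ltr_pdivlMr // => /ltW; apply: le_trans.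
rewrite mulrC -ler_pdivrMr //.
apply: ltW; apply: lt_le_trans (truncnS_gt _) _.
by rewrite ler_nat.
Unshelve. all: by end_near.
Qed.

(* The good event is exchanged for a measurable one whose complement is null. *)
Lemma ae_limit_word : exists bad : set T, [/\ measurable bad, P bad = 0%E &
  forall t, ~ bad t ->
    (forall m, \forall n \near \oo, (m <= fp_length (walk x n t))%N) /\
    exists xi, letterwise_cvg (fun n => walk x n t) xi].
Proof.
have : {ae P, forall t,
   (fp_length (walk x n t))%:R / n%:R @[n --> \oo] --> gamma /\
   forall n, exists2 s, s \in S & x n t = fp_letter s}.
  exact: filterI walk_drift (ae_step_support S_uniq S_gt0 muS x_iid).
move=> [bad [mbad Pbad sbad]]; exists bad; split=> // t nbad.
have [/drift_length gl xs] : (fp_length (walk x n t))%:R / n%:R @[n --> \oo] --> gamma /\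
   forall n, exists2 s, s \in S & x n t = fp_letter s.
  by apply: contrapT => H; apply: nbad; exact: sbad.
split=> //; apply: letterwise_cvg_walk => // n.
by have [s _ xE] := xs n; exists s; rewrite -xE.
Qed.

Lemma letterwise_cylinder (g : nat -> fp) xi w : letterwise_cvg g xi ->
  cylinder w xi <-> \forall n \near \oo, take (size w) (nform (g n)) = w.
Proof.
move=> /(_ (size w)) gxi; split => [xiw|gw].
  by apply: filterS gxi => n ->.
have [n [h1 h2]] := filter_ex (filterI gxi gw).
by rewrite /cylinder /= -h1.
Qed.

Lemma measurable_prefix w :
  measurable [set t | \forall n \near \oo, take (size w) (nform (walk x n t)) = w].
Proof.
rewrite (_ : [set t | _] = \bigcup_n0 \bigcap_(n in [set n | (n0 <= n)%N])
    (walk x n @^-1` [set g | take (size w) (nform g) = w])).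
  apply: bigcupT_measurable => n0; apply: bigcap_measurable; first by exists n0 => /=.
  by move=> n _; exact: measurable_walk.
apply/seteqP; split => t /=.
  by move=> [n0 _ H]; exists n0 => // n /= /H.
by move=> [n0 _ H]; exists n0 => // n /= /H.
Qed.

Lemma limit_word_law :
  exists (Xoo : {RV P >-> iw}) (bad : set T),
  [/\ measurable bad, P bad = 0%E,
    forall t, ~ bad t -> letterwise_cvg (fun n => walk x n t) (Xoo t) &
    forall t, ~ bad t -> forall m, \forall n \near \oo, (m <= fp_length (walk x n t))%N].
Proof.
have [bad [mbad Pbad goodP]] := ae_limit_word.
(* On [bad], where a limit may fail to exist, a fixed word is chosen; off [bad] the preimage of a
   cylinder is an eventual-prefix event of the walk, so [X] is measurable. *)
pose X t : iw := if t \in bad then point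
  else xget point [set xi | letterwise_cvg (fun n => walk x n t) xi].
have XP t : ~ bad t -> letterwise_cvg (fun n => walk x n t) (X t).
  move=> nbad; rewrite /X memNset //.
  exact: (xgetPex point (goodP t nbad).2).
have mX : measurable_fun setT X.
  apply: (@measurability _ _ _ _ setT X (range (@cylinder G1 G2))) => //.
  move=> _ [_ [w _ <-] <-]; rewrite setTI.
  rewrite (_ : _ @^-1` _ = (bad `&` [set _ | cylinder w (point : iw)]) `|`
    ([set t | \forall n \near \oo, take (size w) (nform (walk x n t)) = w] `\` bad)).
    apply: measurableU; last first.
      by apply: measurableD => //; exact: measurable_prefix.
    have [c|c] := pselect (cylinder w (point : iw)).
      by rewrite (_ : [set _ | _] = setT) ?setIT //; apply/seteqP; split.
    by rewrite (_ : [set _ | _] = set0) ?setI0 //; apply/seteqP; split.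
  apply/seteqP; split=> t; have [bt|nbt] := pselect (bad t).
  - by rewrite /= /X mem_set // => c; left.
  - by move=> /= /(letterwise_cylinder _ (XP t nbt)) c; right.
  - by rewrite /= /X mem_set // => -[[]|[]].
  - by move=> [[]//|[/= c _]]; apply/(letterwise_cylinder _ (XP t nbt)).
exists (mfun_Sub (mem_set mX : X \in mfun)), bad; split=> // t nbad.
by have [] := goodP t nbad.
Qed.

(** The integral of the harmonic function [cyl u h] along the walk stays equal to its value at 1,
    the mass of the cylinder under the multiplicative measure. As the function lies between 0 and 1
    and tends almost surely to the indicator of the cylinder event, dominated convergence identifies
    the law. *)
Lemma harmonic_markov_mult :
  exists2 nu : probability iw R, is_harmonic_measure x nu & is_markov_mult r nu.
Proof.
have [X [bad [mbad Pbad XP gl]]] := limit_word_law.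
exists (distribution P X).
  by exists X; split=> //; exists bad; split=> // t /= H; apply: contrapT => /XP.
split=> // [u|w u nwu].
  rewrite r_gt0 /= -(qlet_kap r_gt0 u).
  apply: mulr_ilt1.
  - exact/ltW/(qlet_gt0 r_gt0).
  - exact/ltW/(kap_gt0 r_gt0).
  - exact: le_lt_trans (q_le u) theta_lt1.
  - exact: (kap_lt1 r_gt0 r_sum).
pose h : fp := FreeProd nwu.
have hE : nform h = rcons w u by [].
pose F := cyl r u h.
have F0 g : 0 <= F g by exact: (wcyl_ge0 r_gt0 r_sum q_le theta_lt1).
pose f n : T -> \bar R := EFin \o F \o walk x n.
have IF n : (\int[P]_t f n t = (qw r w * r u)%:E)%E.
  rewrite (integral_walk S_uniq S_gt0 muS x_iid n F0).
  rewrite (avg_harmonic S_gt0); first by rewrite /F (cyl_one r_gt0 hE).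
  exact: (cyl_harmonic S_inv Hq Hkap).
pose C : set T := X @^-1` cylinder (rcons w u).
have mC : measurable C.
  rewrite /C -[X in measurable X]setTI; apply: measurable_funP => //.
  by apply: sub_sigma_algebra; exists (rcons w u).
have t0 := theta_ge0 r_gt0 q_le.
have fC : {ae P, forall t, [set: T] t -> f n t @[n --> \oo] --> (\1_C t)%:E}.
  exists bad; split=> // t /= H; apply: contrapT => nbt; apply: H => _.
  apply: cvg_EFin; first exact: nearW.
  apply/cvgrPdist_le => e e0.
  (* [M] is a length of [g^-1 * h] at which [wcyl_beyond] makes the error at most [e]; it is reached
     once the walk has length at least [M + fp_length h]. *)
  have /cvgrPdist_le /(_ _ e0) : theta ^+ n @[n --> \oo] --> (0 : R).
    by apply: cvg_expr; rewrite ger0_norm.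
  move=> [M _ /(_ M (leqnn _))]; rewrite sub0r normrN ger0_norm ?exprn_ge0 // => Me.
  have bC : \forall n \near \oo, (beyond u (nform ((walk x n t)^-1 * h)%g))%:R = \1_C t :> R.
    have tk n := take_beyond (walk x n t) hE.
    have [c|c] := pselect (C t).
      have /(letterwise_cylinder _ (XP t nbt)) := c.
      apply: filterS => n; rewrite size_rcons => E.
      by rewrite -tk E eqxx indicE mem_set.
    have := XP t nbt (size w).+1; apply: filterS => n E.
    rewrite -tk indicE memNset //; case: eqP => // E'; exfalso; apply: c.
    by rewrite /C /cylinder /= size_rcons -E.
  near=> n.
  have <- : (beyond u (nform ((walk x n t)^-1 * h)%g))%:R = \1_C t :> R by near: n.
  rewrite distrC /= /F /cyl; apply: le_trans (wcyl_beyond r_gt0 r_sum q_le theta_lt1 _ _) _.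
  apply: le_trans Me; rewrite ler_wiXn2l // ?ltW //.
  have : (M + fp_length h <= fp_length (walk x n t))%N by near: n; exact: gl.
  move=> /leq_trans/(_ (fp_lengthM_ge _ h)).
  by rewrite leq_add2r.
have [_ _] := @dominated_convergence _ _ _ P setT measurableT f (EFin \o \1_C)
  (cst 1%E) (fun n => measurable_fun_walk _ _ _) ltac:(exact/measurable_EFinP) fC
  ltac:(exact: finite_measure_integrable_cst) ltac:(apply: aeW => t n _ /=;
    rewrite lee_fin ger0_norm //; exact: (wcyl_le1 r_gt0 r_sum q_le theta_lt1)).
under eq_fun do rewrite IF.
rewrite integral_indic // setIT => /cvg_lim; rewrite lim_cst // => ->.
by [].
Unshelve. all: by end_near.
Qed.

End LimitWord.

(** * The groups ['Z_2] and ['Z_k], and the conclusion *)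

Lemma generator_order_Zk k (b : 'Z_k) : (1 < k)%N ->
  generator [set: 'Z_k]%G b -> #[b]%g = k.
Proof.
move=> k1 /eqP gb; rewrite orderE -gb cardsT card_ord.
by rewrite Zp_cast.
Qed.

Lemma Z2_uniq (x y : {x : 'Z_2 | x != 1%g}) : x = y.
Proof.
apply/val_inj; case: x y => [[[|[|x]] hx] x1] [[[|[|y]] hy] y1] //=; exact/val_inj.
Qed.

Section MainTheorem.
Variables (R : realType) (k : nat) (y : R).
Hypothesis k3 : (3 <= k)%N.
Hypothesis y01 : 0 < y < 1 / 2.
Hypothesis yfix : Gfun k.-1 y = y.

Lemma harmonic_drift (a : 'Z_2) (b : 'Z_k) :
  generator [set: 'Z_2]%G a -> generator [set: 'Z_k]%G b ->
  forall mu : probability (freeprod 'Z_2 'Z_k) R,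
  mu [set fp_inl 'Z_k a] = (1 / 3)%:E ->
  mu [set fp_inr 'Z_2 b] = (1 / 3)%:E ->
  mu [set (fp_inr 'Z_2 b)^-1%g] = (1 / 3)%:E ->
  forall r : letter 'Z_2 'Z_k -> R,
  (forall u, val u = a -> r (inl u) = Gfun 0 y) ->
  (forall i u, (1 <= i <= k.-1)%N -> val u = (b ^+ i)%g ->
     r (inr u) = Gfun i y) ->
  forall (d : measure_display) (T : measurableType d) (P : probability T R)
    (x : nat -> {RV P >-> freeprod 'Z_2 'Z_k}),
  iid_of_law mu x ->
  (exists2 nu : probability (infword 'Z_2 'Z_k) R,
     is_harmonic_measure x nu & is_markov_mult r nu) /\
  is_drift x ((1 - 2 * y) / 3).
Proof.
move=> ga gb mu mua mub mub' r ra rb d T P x x_iid.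
have ob : #[b]%g = k by apply: generator_order_Zk => //; exact: ltnW.
have a1 : a != 1%g.
  apply/eqP => a1; have := @generator_order_Zk 2 a isT ga.
  by rewrite a1 order1.
have b1 : b != 1%g.
  by apply/eqP => b1; move: k3; rewrite -ob b1 order1.
pose a' : {x : 'Z_2 | x != 1%g} := exist (fun x : 'Z_2 => x != 1%g) a a1.
pose b' : {x : 'Z_k | x != 1%g} := exist (fun x : 'Z_k => x != 1%g) b b1.
have aE : fp_inl 'Z_k a = fp_letter (inl a').
  by rewrite /fp_inl (insubT (fun x : 'Z_2 => x != 1%g) a1).
have bE : fp_inr 'Z_2 b = fp_letter (inr b').
  by rewrite /fp_inr (insubT (fun x : 'Z_k => x != 1%g) b1).
pose S := steps a' b'.
have S_uniq : uniq S.
  (* The three steps are distinct: [b = b^-1] would make the order of [b] divide 2, whereas it is at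
     least 3. *)
  rewrite /= !inE /= andbT; apply/eqP => -[bb].
  have : (#[b]%g %| 2)%N by rewrite order_dvdn expgS expg1 {1}bb mulVg.
  by rewrite ob => /(dvdn_leq (isT : 0 < 2)%N); rewrite leqNgt k3.
have muS s : s \in S -> mu [set fp_letter s] = ((size S)%:R^-1)%:E.
  rewrite [size S]/= -[_^-1]mul1r !inE => /or3P[] /eqP ->.
  - by rewrite -aE.
  - by rewrite -bE.
  - by rewrite -fp_letterV -bE.
have gb' : [set: 'Z_k]%G = <[val b']>%g :> {set 'Z_k} by exact/eqP.
have a_uniq (u : {x : 'Z_2 | x != 1%g}) : u = a' by exact: Z2_uniq.
have ob' : #[val b']%g = k by [].
have ra' : r (inl a') = Gfun 0 y by exact: ra.
have r_gt0 := r_pos k3 y01 yfix a_uniq ob' gb' ra' rb.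
have [r_sum _] := sum_letters k3 y01 yfix a_uniq ob' gb' ra' rb.
have [theta theta1 q_le] := q_bound k3 y01 yfix a_uniq ob' gb' ra' rb.
have Hinv := @steps_inv _ _ a' b' a_uniq.
have Hq := steps_q k3 y01 yfix a_uniq ob' gb' ra' rb.
have Hkap := steps_kap k3 y01 yfix a_uniq ob' gb' ra' rb.
have Hdrift := steps_drift k3 y01 yfix a_uniq ob' gb' ra' rb.
have Hdrift1 := steps_drift1 k3 y01 yfix a_uniq ob' gb' ra' rb.
have gamma0 : 0 < (1 - 2 * y) / 3 by case/andP: y01 => *; lra.
split.
  exact: (harmonic_markov_mult S_uniq isT r_gt0 r_sum q_le theta1 Hinv Hq Hkap
    Hdrift Hdrift1 gamma0 muS x_iid).
exact: (walk_drift S_uniq isT r_gt0 r_sum q_le theta1 Hinv Hq Hdrift Hdrift1 muS x_iid).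
Qed.

End MainTheorem.

Theorem theorem2p4 (R : realType) :
  exists y : nat -> R,
  [/\ forall k, (3 <= k)%N ->
        unique (fun z : R => 0 < z < 1 / 2 /\ Gfun k.-1 z = z) (y k),
      forall k, (3 <= k)%N ->
      forall (a : 'Z_2) (b : 'Z_k),
        generator [set: 'Z_2]%G a -> generator [set: 'Z_k]%G b ->
      forall mu : probability (freeprod 'Z_2 'Z_k) R,
        mu [set fp_inl 'Z_k a] = (1 / 3)%:E ->
        mu [set fp_inr 'Z_2 b] = (1 / 3)%:E ->
        mu [set (fp_inr 'Z_2 b)^-1%g] = (1 / 3)%:E ->
      forall r : letter 'Z_2 'Z_k -> R,
        (forall u, val u = a -> r (inl u) = Gfun 0 (y k)) ->
        (forall i u, (1 <= i <= k.-1)%N -> val u = (b ^+ i)%g ->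
          r (inr u) = Gfun i (y k)) ->
      forall (d : measure_display) (T : measurableType d) (P : probability T R)
        (x : nat -> {RV P >-> freeprod 'Z_2 'Z_k}),
        iid_of_law mu x ->
        (exists2 nu : probability (infword 'Z_2 'Z_k) R,
           is_harmonic_measure x nu & is_markov_mult r nu) /\
        is_drift x ((1 - 2 * y k) / 3),
      forall k l, (3 <= k)%N -> (k < l)%N ->
        (1 - 2 * y k) / 3 < (1 - 2 * y l) / 3 &
      (1 - 2 * y k) / 3 @[k --> \oo] --> (2 / 9 : R)].
Proof.
(* For [k] below 3 the value of [y k] is arbitrary. *)
have /choice[y yP] : forall k, exists z : R, (3 <= k)%N ->
    0 < z < 1 / 2 /\ gap k (excess z) = target z.
  move=> k; have [k3|_] := leqP 3 k; last by exists 0.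
  by have [z zP] := @gap_target_exists R k k3; exists z.
have y01 k : (3 <= k)%N -> 0 < y k < 1 / 2 by move=> /yP[].
have yfix k : (3 <= k)%N -> Gfun k.-1 (y k) = y k.
  by move=> k3; apply/(Gfun_fixP k3 (y01 k k3)); have [] := yP k k3.
have lt_le (z : R) : 0 < z < 1 / 2 -> 0 <= z <= 1 / 2.
  by move=> /andP[z0 z1]; rewrite !ltW.
exists y; split.
- move=> k k3; split; first by split; [exact: y01|exact: yfix].
  move=> z [z01 zfix]; apply: (@gap_target_inj R k); [exact/lt_le/y01|exact: lt_le| |].
    by have [] := yP k k3.
  exact/(Gfun_fixP k3 z01).
- by move=> k k3 a b ga gb; exact: (harmonic_drift k3 (y01 k k3) (yfix k k3) ga gb).
- move=> k l k3 kl; have l3 := ltn_trans k3 kl.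
  have [yk sk] := yP k k3; have [yl sl] := yP l l3.
  have := gap_target_lt kl (lt_le _ yk) (lt_le _ yl) sk sl; lra.
suff yl : y k @[k --> \oo] --> (1 / 6 : R).
  have -> : 2 / 9 = (1 - 2 * (1 / 6)) / 3 :> R by field.
  apply: cvgM; last exact: cvg_cst.
  by apply: cvgB; [exact: cvg_cst|apply: cvgM => //; exact: cvg_cst].
(* The bound of [gap_target_near] involves [k.+2]; [harmonic k] is the inverse of [k.+1], hence
   larger. *)
apply: (@squeeze_cvgr _ _ _ _ (cst (1 / 6)) (fun k => 1 / 6 + 8 / 3 * harmonic k)).
- exists 3%N => // k /= k3; have [yk sk] := yP k k3.
  have /andP[/ltW -> /= h] := gap_target_near yk sk.
  apply: le_trans h _; rewrite lerD2l ler_pM2l; last by lra.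
  by rewrite lef_pV2 ?posrE // ler_nat.
- exact: cvg_cst.
- rewrite -[X in _ --> X]addr0 -(mulr0 (8 / 3)); apply: cvgD; first exact: cvg_cst.
  by apply: cvgM; [exact: cvg_cst|exact: cvg_harmonic].
Qed.
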